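(* Let $\epsilon\in(0,1/2)$, let $(\lambda_j)_{j\ge 1}$ be a sequence of positive numbers with $\sum_{j\ge1}\lambda_j=1$, let $(m_j)_{j\ge 1}$ be an increasing sequence of positive odd integers, and let $p$ be the Bramson-Kalikow model with parameters $\epsilon,(\lambda_j)_{j\ge1},(m_j)_{j\ge1}$. Let $m_0=0$, let $r:\{1,2,\ldots\}\to\{0,1,2,\ldots\}$, $k\mapsto r_k$, be a function such that $r_k<k$ for all $k\geq 1$, and let $\alpha\in(0,\frac12-\epsilon)$. Suppose that for all $k\ge 0$ we have $\sum_{j\ge k+2}\lambda_j>\sum_{j=r_{k+1}+1}^{k+1}\lambda_j$ and $$m_{k+1}\ \ge\ \frac{A_k}{\left(\sum_{j\ge k+2}\lambda_j-\sum_{j=r_{k+1}+1}^{k+1}\lambda_j\right)^2},$$ where $$A_k:=8\,(1-2\epsilon)^{-2}\left(1+m_{r_{k+1}}(2\epsilon)^{-m_{r_{k+1}}}\right)^2\ln\left(2^{k+2}\left(1+m_k(2\epsilon)^{-m_k}\right)\alpha^{-1}\right).$$ Then $p$ has multiple $p$-measures, i.e. there exist at least two distinct $p$-measures.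
   Context: Let $A=\{-1,+1\}$ and $\mathcal X=A^{\mathbb Z_-}$, where $\mathbb Z_-=\{\ldots,-2,-1,0\}$, with the product topology (compact metrizable) and Borel $\sigma$-algebra. $\mathcal C(\mathcal X)$ is the space of continuous real functions on $\mathcal X$ with the sup norm. For $a\in A$ and $x\in\mathcal X$, the concatenation $ax\in\mathcal X$ is defined by $(ax)_0=a$ and $(ax)_{-i-1}=x_{-i}$ for $i\ge0$. The shift $T:\mathcal X\to\mathcal X$ is $(Tx)_i=x_{i-1}$. Let $\mathcal G$ be the set of $g\in\mathcal C(\mathcal X)$ with $g(x)\in(0,1)$ and $\sum_{a\in A}g(ax)=1$ for all $x\in\mathcal X$. For $g\in\mathcal G$, a $g$-measure is a $T$-invariant Borel probability measure $\mu$ on $\mathcal X$ such that $\mu(\{x\in\mathcal X: x_0=a\}\mid T^{-1}\mathcal B)(x)=g(ax_{-\infty}^{-1})$ for $a\in A$ ($\mu$-a.s.), where $\mathcal B$ is the Borel $\sigma$-algebra; equivalently $\int f\,d\mu=\int\sum_{a\in A}g(ax)f(ax)\,d\mu(x)$ for all $f\in\mathcal C(\mathcal X)$. The Bramson-Kalikow (BK) model with parameters $\epsilon,(\lambda_j),(m_j)$ is the function $p\in\mathcal G$ given by $p(x)=\sum_{j=1}^\infty\lambda_j\,p_{[m_j]}(x)$, where $$p_{[m_j]}(x)=\mathbf 1\Big\{x_0\sum_{l=1}^{m_j}x_{-l}>0\Big\}(1-\epsilon)+\mathbf 1\Big\{x_0\sum_{l=1}^{m_j}x_{-l}<0\Big\}\epsilon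 .$$ *)

(* Defs.v *)
From HB Require Import structures.
From mathcomp Require Import all_boot all_order all_algebra.
From mathcomp Require Import all_classical all_reals all_analysis.

Set Implicit Arguments.
Unset Strict Implicit.
Unset Printing Implicit Defensive.

Import Order.TTheory GRing.Theory Num.Theory.
Import numFieldNormedType.Exports.

Local Open Scope classical_set_scope.
Local Open Scope ring_scope.

(* The alphabet {-1, +1} is encoded by bool (true is +1, false is -1), and a
   left-infinite sequence x is stored as n |-> x_{-n}; cantor_space is nat -> bool
   with the product of the discrete topologies. *)
Definition spin {R : realType} (a : bool) : R := if a then 1 else -1.

Notation config := cantor_space.

Definition borel_config := g_sigma_algebraType (@open config).

Definition concat (a : bool) (x : config) : config :=
  fun n => if n is n'.+1 then x n' else a.

Definition cshift (x : config) : config := fun n => x n.+1.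

Definition shift_preimages : set_system borel_config :=
  preimage_set_system setT (cshift : borel_config -> borel_config) measurable.

Definition g_function {R : realType} (g : config -> R) : Prop :=
  [/\ continuous g,
      forall x, 0 < g x < 1 &
      forall x, \sum_(a : bool) g (concat a x) = 1].

(* h is a version of the conditional probability P(E | F), for a
   sub-sigma-algebra F. *)
Definition is_cond_prob d (U : measurableType d) (R : realType)
    (P : probability U R) (F : set_system U) (E : set U) (h : U -> R) : Prop :=
  [/\ forall Y : set R, measurable Y -> F (h @^-1` Y),
      P.-integrable setT (EFin \o h) &
      forall B, F B -> (\int[P]_(x in B) (h x)%:E = P (E `&` B))%E].

(* concat a (cshift x) is x with its coordinate x_0 replaced by a. *)
Definition g_measure {R : realType} (g : config -> R)
    (mu : probability borel_config R) : Prop :=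
  [/\ g_function g,
      forall B : set borel_config, measurable B -> mu (cshift @^-1` B) = mu B &
      forall a : bool, exists2 h : borel_config -> R,
        is_cond_prob mu shift_preimages [set x : borel_config | x 0%N = a] h &
        {ae mu, forall x, h x = g (concat a (cshift x))}].

(* Majority rule over the m coordinates x_{-1}, ..., x_{-m}. *)
Definition majority {R : realType} (eps : R) (m : nat) (x : config) : R :=
  let s : R := spin (x 0%N) * \sum_(1 <= l < m.+1) spin (x l) in
  (0 < s)%R%:R * (1 - eps) + (s < 0)%R%:R * eps.

Definition bramson_kalikow {R : realType} (eps : R) (lambda : nat -> R)
    (m : nat -> nat) (x : config) : R :=
  \big[+%R/0]_(1 <= j <oo) (lambda j * majority eps (m j) x).

Definition gap {R : realType} (lambda : nat -> R) (r : nat -> nat) (k : nat) : R :=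
  \big[+%R/0]_(k.+2 <= j <oo) lambda j - \sum_((r k.+1).+1 <= j < k.+2) lambda j.

Definition A_bound {R : realType} (eps alpha : R) (m r : nat -> nat) (k : nat) : R :=
  let w n : R := 1 + (m n)%:R * (2 * eps) ^- m n in
  8 * (1 - 2 * eps) ^- 2 * w (r k.+1) ^+ 2 * ln (2 ^+ k.+2 * w k * alpha^-1).

(* Main.v *)
Require Import Defs.
From HB Require Import structures.
From mathcomp Require Import all_boot all_order all_algebra.
From mathcomp Require Import all_classical all_reals all_analysis.
From mathcomp Require Import measurable_realfun lra ring.
Import Order.TTheory GRing.Theory Num.Theory.
Import numFieldNormedType.Exports.
Local Open Scope classical_set_scope.
Local Open Scope ring_scope.

Set Implicit Arguments.
Unset Strict Implicit.
Unset Printing Implicit Defensive.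

(** Two p-measures come from two starts of the chain that draws each new spin from
    p, the all-plus and the all-minus past: a limit of Cesaro averages of the laws of
    the chain is a p-measure (g_measure_exists), and by the spin-flip symmetry the
    two limits differ as soon as the chain started from all plus has at all times a
    plus spin with probability at least some constant c > 1/2.  The bound obtained
    is c = 1 - eps - alpha / 2 (bk_plus_magnetized).

    It is proved along the chains truncated k, which use the first k majority rules
    and let the remaining weight vote plus.  For k = 0 the spins are independent and
    plus with probability 1 - eps; as k grows, the truncated chains approach p.
    Passing from k to k + 1 costs only at the times when the last m_(k+1) spins have
    a minus majority, and each such error is remembered for a bounded mean time,
    because the chain truncated at k has memory m_k and forgets its past after m_k
    consecutive fair coin tosses, which have probability (2 eps)^(m_k)
    (memory_decay).  Hence the loss is at most the probability of a minus majority
    times memory_cost eps (m_k) (iter_step_compare).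

    A minus majority is unlikely for the following reason.  All rules are
    attractive, so letting the rules after r_(k+1) and up to k + 1 always vote minus
    only lowers the spins.  What remains is a symmetric chain of the shorter
    memory m_(r_(k+1)), biased by the constant field gap lambda r k > 0.  Its
    magnetization is at least (1 - 2 eps) gap (magnetization_ge_field), and the sum
    of a block of spins is concentrated around its mean with exponential
    precision, by the method of bounded martingale differences
    (block_sum_concentration).  The growth condition on m_(k+1) is what makes
    the loss at stage k at most alpha / 2^(k+2), and these losses add up to at most
    alpha / 2. *)

(** * The one-step operator of a binary chain *)

(** The conditional expectation, given the past x, of f at the configuration
    obtained by adding one spin, which is plus with probability q x.  Thus
    iter n (step q) f x is the expectation of f after n steps from x; all the
    probability needed before the construction of the measures is expressed by
    these iterates. *)
Definition step {R : realType} (q f : config -> R) : config -> R :=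
  fun x => q x * f (concat true x) + (1 - q x) * f (concat false x).

Definition config_le (x y : config) := forall i, x i ==> y i.
Definition increasing {R : realType} (f : config -> R) :=
  forall x y, config_le x y -> f x <= f y.

Definition local {T} (n : nat) (f : config -> T) :=
  forall x y : config, (forall i, (i < n)%N -> x i = y i) -> f x = f y.

Definition plus_spin {R : realType} (x : config) : R := (x 0%N)%:R.

Section Step.
Context {R : realType}.
Implicit Types (q f g : config -> R) (x y : config).

Definition prob_valued q := forall x, 0 <= q x <= 1.

Lemma step_le q f g : prob_valued q ->
  (forall x, f x <= g x) -> forall x, step q f x <= step q g x.
Proof.
move=> hq fg x; have /andP[q0 q1] := hq x.
by rewrite lerD// ler_wpM2l// subr_ge0.
Qed.

Lemma iter_step_le q f g n : prob_valued q ->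
  (forall x, f x <= g x) -> forall x, iter n (step q) f x <= iter n (step q) g x.
Proof. by move=> hq fg; elim: n => //= n IH x; exact: step_le. Qed.

Lemma iter_step_affine q f a c n x :
  iter n (step q) (fun y => a * f y + c) x = a * iter n (step q) f x + c.
Proof.
elim: n x => //= n IH x; rewrite /step !IH.
ring.
Qed.

Lemma iter_step_cst q (c : R) n x : iter n (step q) (fun=> c) x = c.
Proof.
have -> : (fun=> c) = (fun y : config => 0 * (fun=> 0) y + c) :> (config -> R).
  by apply/funext => y; rewrite mul0r add0r.
by rewrite iter_step_affine mul0r add0r.
Qed.

Lemma iter_step_ge_cst q f c n x : prob_valued q ->
  (forall y, c <= f y) -> c <= iter n (step q) f x.
Proof.
by move=> hq cf; rewrite -(iter_step_cst q c n x); exact: iter_step_le.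
Qed.

Lemma iter_step_le_cst q f c n x : prob_valued q ->
  (forall y, f y <= c) -> iter n (step q) f x <= c.
Proof.
by move=> hq cf; rewrite -(iter_step_cst q c n x); exact: iter_step_le.
Qed.

Lemma iter_stepD q f g n x :
  iter n (step q) (fun y => f y + g y) x =
  iter n (step q) f x + iter n (step q) g x.
Proof.
elim: n x => //= n IH x; rewrite /step !IH.
ring.
Qed.

Lemma iter_stepZ q f c n x :
  iter n (step q) (fun y => c * f y) x = c * iter n (step q) f x.
Proof.
rewrite -[RHS]addr0 -iter_step_affine; congr (iter _ _ _ _).
by apply/funext => y; rewrite addr0.
Qed.

Lemma config_le_concat a a' x y :
  a ==> a' -> config_le x y -> config_le (concat a x) (concat a' y).
Proof. by move=> aa xy [|i] //=; exact: xy. Qed.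

Lemma config_le_refl x : config_le x x.
Proof. by move=> i; rewrite implybb. Qed.

Lemma increasing_concat f x : increasing f -> f (concat false x) <= f (concat true x).
Proof.
by move=> fi; apply: fi; apply: config_le_concat => //; exact: config_le_refl.
Qed.

Lemma step_increasing q f : prob_valued q -> increasing q ->
  increasing f -> increasing (step q f).
Proof.
move=> hq qi fi x y xy; rewrite /step.
have /andP[q0 q1] := hq x.
have qxy := qi _ _ xy.
have h1 := fi _ _ (@config_le_concat true true _ _ isT xy).
have h2 := fi _ _ (@config_le_concat false false _ _ isT xy).
have h3 := increasing_concat y fi.
nra.
Qed.

Lemma iter_step_increasing q f n : prob_valued q -> increasing q ->
  increasing f -> increasing (iter n (step q) f).
Proof. by move=> hq qi fi; elim: n => //= n IH; exact: step_increasing. Qed.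

(** An increasing observable sees more of the chain that is more likely to
    produce a plus spin: raising q moves mass from the lower to the higher
    value. *)
Lemma iter_step_le_drift q q' f n : prob_valued q -> prob_valued q' ->
  increasing q -> (forall x, q x <= q' x) -> increasing f ->
  forall x, iter n (step q) f x <= iter n (step q') f x.
Proof.
move=> hq hq' qi qq' fi; elim: n => //= n IH x.
apply: (le_trans _ (step_le hq' IH x)).
have h := increasing_concat x (iter_step_increasing n hq qi fi).
have := qq' x; rewrite /step; nra.
Qed.

Lemma step_plus_spin q x : step q plus_spin x = q x.
Proof. by rewrite /step /plus_spin /= mulr1 mulr0 addr0. Qed.

Lemma step_local q f n : local n q -> local n.+1 f -> local n (step q f).
Proof.
move=> ql fl x y xy; rewrite /step (ql _ _ xy).
have h a : f (concat a x) = f (concat a y).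
  by apply: fl => -[|i] //= ?; exact: xy.
by rewrite !h.
Qed.

Lemma localW {T} (f : config -> T) n n' : (n <= n')%N -> local n f -> local n' f.
Proof. by move=> nn' fl x y xy; apply: fl => i ?; apply: xy; exact: leq_trans nn'. Qed.

Lemma iter_step_local q f n u : local n q -> local n f -> local n (iter u (step q) f).
Proof.
by move=> ql fl; elim: u => //= u IH; apply: step_local => //; exact: localW IH.
Qed.

End Step.

(** * Loss of memory *)

Section Memory.
Context {R : realType} (eps : R).
Hypothesis heps : 0 < eps < 1 / 2.
Implicit Types (q f g : config -> R) (x y : config).

Definition elliptic q := forall x, eps <= q x <= 1 - eps.

Lemma elliptic_prob_valued q : elliptic q -> prob_valued q.
Proof. by move=> hq x; have := hq x; have := heps; lra. Qed.

Let half : config -> R := fun=> 1 / 2.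

Lemma half_prob_valued : prob_valued half.
Proof. by move=> x; rewrite /half; lra. Qed.

(** The chain draws each new spin by a fair coin with probability at least 2 eps;
    the term on the left keeps the paths on which this happens n times in a row. *)
Lemma iter_step_minor q f n x : elliptic q -> (forall y, 0 <= f y) ->
  (2 * eps) ^+ n * iter n (step half) f x <= iter n (step q) f x.
Proof.
move=> hq f0; elim: n x => [x|n IH x]; first by rewrite expr0 mul1r.
have h0 y : 0 <= iter n (step half) f y.
  by apply: iter_step_ge_cst => //; exact: half_prob_valued.
rewrite /= [X in X <= _](_ : _ = 2 * eps * step half
   (fun y => (2 * eps) ^+ n * iter n (step half) f y) x); last first.
  by rewrite /step exprS; ring.
apply: (le_trans _ (step_le (elliptic_prob_valued hq) IH x)).
have /andP[q0 q1] := hq x; have /andP[e0 e1] := heps.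
have p0 : 0 <= (2 * eps) ^+ n by rewrite exprn_ge0// mulr_ge0// ltW.
have := mulr_ge0 p0 (h0 (concat true x)); have := mulr_ge0 p0 (h0 (concat false x)).
rewrite /step /half; nra.
Qed.

Lemma iter_half_local f n k : local (n + k) f -> local k (iter n (step half) f).
Proof.
elim: n k => //= n IH k fl; apply: step_local => //.
by apply: IH; rewrite addnS.
Qed.

Definition osc_le f c := forall x y, f x - f y <= c.

(** Doeblin's argument: an observable of M spins has the same fair-coin average a
    from all starting points, and this average makes up the proportion (2 eps)^M of
    its expectation after M steps. *)
Lemma osc_block q f M c : (0 < M)%N -> elliptic q -> local M f -> osc_le f c ->
  osc_le (iter M (step q) f) ((1 - (2 * eps) ^+ M) * c).
Proof.
move=> M0 hq fl fc x y.
have /andP[e0 e1] := heps.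
set rho := (2 * eps) ^+ M.
have rho1 : rho < 1 by rewrite exprn_ilt1 -?lt0n//; lra.
have hp := elliptic_prob_valued hq.
pose a := iter M (step half) f x.
have aE z : iter M (step half) f z = a.
  by apply: (@iter_half_local f M 0) => //; rewrite addn0.
have lo c' z : (forall y', c' <= f y') ->
    rho * a + (1 - rho) * c' <= iter M (step q) f z.
  move=> lof; have := @iter_step_minor q (fun y => 1 * f y + - c') M z hq.
  rewrite !iter_step_affine aE -/rho !mul1r => h.
  have /h : forall y0, 0 <= 1 * f y0 - c' by move=> y0; have := lof y0; lra.
  lra.
have hi c' z : (forall y', f y' <= c') ->
    iter M (step q) f z <= rho * a + (1 - rho) * c'.
  move=> lof; have := @iter_step_minor q (fun y => - 1 * f y + c') M z hq.
  rewrite !iter_step_affine aE -/rho => h.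
  have /h : forall y0, 0 <= - 1 * f y0 + c' by move=> y0; have := lof y0; lra.
  lra.
set F := iter M (step q) f.
have key y' : (F x - rho * a) / (1 - rho) - c <= f y'.
  rewrite lerBlDr ler_pdivrMr; last lra.
  rewrite lerBlDr; apply: (le_trans (@hi (f y' + c) x _)); last by lra.
  by move=> z; have := fc z y'; lra.
have := @lo _ y key; rewrite mulrBr mulrCA divff ?mulr1; last by rewrite gt_eqF//; lra.
rewrite -/F; lra.
Qed.

Lemma osc_step q f c n : prob_valued q -> osc_le f c ->
  osc_le (iter n (step q) f) c.
Proof.
move=> hq fc x y.
have key z : iter n (step q) f x <= f z + c.
  by apply: iter_step_le_cst => // w; have := fc w z; lra.
suff : iter n (step q) f x - c <= iter n (step q) f y by lra.
by apply: iter_step_ge_cst => // z; have := key z; lra.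
Qed.

Lemma osc_plus_spin : osc_le (@plus_spin R) 1.
Proof. by move=> x y; rewrite /plus_spin; case: (x _); case: (y _);
  rewrite /= ?mulr1n ?mulr0n; lra. Qed.

Definition memory_cost (M : nat) : R := 1 + M%:R * (2 * eps) ^- M.

Lemma memory_cost_ge1 M : 1 <= memory_cost M.
Proof.
have /andP[e0 e1] := heps.
by rewrite /memory_cost lerDl mulr_ge0// invr_ge0 exprn_ge0//; lra.
Qed.

(** The sum over a block of M indices is M times a term of a geometric series. *)
Lemma sum_block_geometric (rho : R) M n : 0 < rho <= 1 ->  (0 < M)%N ->
  \sum_(0 <= u < n) (1 - rho) ^+ (u %/ M) <= M%:R / rho.
Proof.
move=> /andP[rho0 rho1] M0.
have p0 u : 0 <= (1 - rho) ^+ u by rewrite exprn_ge0//; lra.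
apply: (@le_trans _ _ (\sum_(0 <= u < n * M) (1 - rho) ^+ (u %/ M))).
  rewrite (@big_cat_nat _ _ _ n 0 (n * M))//=; last by rewrite leq_pmulr.
  by rewrite lerDl sumr_ge0.
have -> : \sum_(0 <= u < n * M) (1 - rho) ^+ (u %/ M) =
    M%:R * \sum_(0 <= i < n) (1 - rho) ^+ i.
  elim: n => [|n IH]; first by rewrite mul0n !big_geq// mulr0.
  rewrite (@big_cat_nat _ _ _ (n * M) 0)//=; last by rewrite leq_mul2r leqnSn orbT.
  rewrite IH big_nat_recr//= mulrDr; congr (_ + _).
  rewrite (eq_big_nat _ _ (F2 := fun=> (1 - rho) ^+ n)).
    by rewrite sumr_const_nat mulSn addnK mulr_natl.
  move=> i /andP[h1 h2]; congr (_ ^+ _).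
  by apply/eqP; rewrite eqn_leq -ltnS ltn_divLR// h2 leq_divRL.
rewrite ler_wpM2l// -[rho^-1]mul1r ler_pdivlMr//.
suff -> : (\sum_(0 <= i < n) (1 - rho) ^+ i) * rho = 1 - (1 - rho) ^+ n.
  by rewrite lerBlDr lerDl.
elim: n => [|n IH]; first by rewrite big_geq// mul0r expr0 subrr.
by rewrite big_nat_recr//= mulrDl IH exprSr; ring.
Qed.

(** A chain with memory M that gives each spin probability at least eps draws,
    with probability (2 eps)^M, M consecutive spins by fair coin tosses, and has
    then forgotten its past.  Hence one spin of the past changes, in the mean,
    at most memory_cost M later spins. *)
Lemma memory_decay q M : elliptic q -> local M q ->
  exists d : nat -> R,
    [/\ forall u, 0 <= d u,
        forall u, osc_le (iter u (step q) plus_spin) (d u) &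
        forall n, \sum_(0 <= u < n) d u <= memory_cost M].
Proof.
move=> hq ql; have /andP[e0 e1] := heps.
have hp := elliptic_prob_valued hq.
case: M ql => [|M] ql.
  exists (fun u => (u == 0%N)%:R); split => [u|[|u]|n] //.
  - exact: osc_plus_spin.
  - move=> x y; rewrite iterSr.
    have -> : step q plus_spin = (fun=> q x).
      by apply/funext => z; rewrite step_plus_spin; apply: ql.
    by rewrite !iter_step_cst subrr.
  - rewrite /memory_cost mul0r addr0; case: n => [|n]; first by rewrite big_geq.
    by rewrite big_nat_recl//= big1 ?addr0.
set rho := (2 * eps) ^+ M.+1.
have rho0 : 0 < rho by rewrite exprn_gt0//; lra.
have rho1 : rho <= 1 by rewrite exprn_ile1//; lra.
have fl : local M.+1 (@plus_spin R) by move=> x y xy; rewrite /plus_spin xy.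
exists (fun u => (1 - rho) ^+ (u %/ M.+1)); split.
- by move=> u; rewrite exprn_ge0//; lra.
- move=> u; rewrite [in iter u _ _](divn_eq u M.+1) addnC iterD.
  apply: osc_step => //; elim: (u %/ M.+1)%N => [|k IH].
    by rewrite expr0; exact: osc_plus_spin.
  rewrite mulSn iterD exprS; apply: osc_block => //.
  exact: iter_step_local.
- move=> n; apply: (@le_trans _ _ (M.+1%:R / rho)).
    by apply: sum_block_geometric; rewrite ?rho0.
  by rewrite /memory_cost -/rho lerDr.
Qed.

End Memory.

(** * Concentration of block sums *)

Section Concentration.
Context {R : realType}.
Implicit Types (q f g : config -> R) (x y : config).

Definition spin0 x : R := spin (x 0%N).

Definition spin_sum (n : nat) x : R := \sum_(0 <= l < n) spin (x l).

(** From exp (- y / 2) >= 1 - y / 2, whose square dominates the inverse of the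
    right-hand side on this range. *)
Lemma expR_le_quad (y : R) : - (1 / 2) <= y <= 1 / 2 ->
  expR y <= 1 + y + 4 / 3 * y ^+ 2.
Proof.
move=> hy; have h1 := expR_ge1Dx (- (y / 2)).
have h2 : expR y * expR (- (y / 2)) ^+ 2 = 1.
  rewrite expr2 -!expRD; have -> : y + (- (y / 2) + - (y / 2)) = 0 by field.
  exact: expR0.
have h3 := expR_gt0 y.
set e := expR (- (y / 2)) in h1 h2 *.
have h4 : (1 - y / 2) ^+ 2 <= e ^+ 2.
  by rewrite ler_sqr ?nnegrE; lra.
have h5 : expR y * (1 - y / 2) ^+ 2 <= 1.
  have := h1; rewrite !expr2; have : 0 <= 1 - y / 2 by lra.
  nra.
have h6 : 1 <= (1 + y + 4 / 3 * y ^+ 2) * (1 - y / 2) ^+ 2.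
  have -> : (1 + y + 4 / 3 * y ^+ 2) * (1 - y / 2) ^+ 2 =
     1 + y ^+ 2 * (7 / 12 - 13 / 12 * y + y ^+ 2 / 3) by field.
  by rewrite lerDl mulr_ge0 ?sqr_ge0//; have := sqr_ge0 y; lra.
have h7 : 0 < (1 - y / 2) ^+ 2 by rewrite exprn_gt0//; lra.
by rewrite -(ler_pM2r h7) (le_trans h5).
Qed.

(** Hoeffding's inequality for the centred variable with the two values
    - (1 - p) D and p D, with 1/3 in place of the optimal constant 1/8. *)
Lemma two_point_mgf (p D : R) : 0 <= p <= 1 -> - (1 / 2) <= D <= 1 / 2 ->
  p * expR (- (1 - p) * D) + (1 - p) * expR (p * D) <= expR (D ^+ 2 / 3).
Proof.
move=> hp hD.
have h1 : expR (- (1 - p) * D) <= 1 + - (1 - p) * D + 4 / 3 * (- (1 - p) * D) ^+ 2.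
  apply: expR_le_quad; nra.
have h2 : expR (p * D) <= 1 + p * D + 4 / 3 * (p * D) ^+ 2.
  apply: expR_le_quad; nra.
apply: (le_trans _ (expR_ge1Dx _)).
have : p * expR (- (1 - p) * D) + (1 - p) * expR (p * D) <=
  p * (1 + - (1 - p) * D + 4 / 3 * (- (1 - p) * D) ^+ 2) +
  (1 - p) * (1 + p * D + 4 / 3 * (p * D) ^+ 2).
  by rewrite lerD// ler_wpM2l//; lra.
move=> /le_trans; apply.
have h := sqr_ge0 (D * (1 - 2 * p)); have hh := sqr_ge0 D.
lra.
Qed.

(** After n steps the coordinates from n on are the initial configuration. *)
Lemma iter_step_shift q f g n x :
  iter n (step q) (fun y => f y * g (iter n cshift y)) x =
  g x * iter n (step q) f x.
Proof.
elim: n g x => [|n IH] g x; first by rewrite /= mulrC.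
rewrite iterS.
have E : iter n (step q) (fun y => f y * g (iter n.+1 cshift y)) =
   (fun y => g (cshift y) * iter n (step q) f y).
  by apply/funext => y; rewrite -(IH (fun z => g (cshift z))).
rewrite E /step /=.
have h a : cshift (concat a x) = x by apply/funext.
by rewrite !h; ring.
Qed.

(** The moment generating function of the next n spins, given the past x. *)
Definition block_mgf q (theta : R) n x : R :=
  iter n (step q) (fun y => expR (- theta * spin_sum n y)) x.

Lemma block_mgfS q theta n x :
  block_mgf q theta n.+1 x =
  step q (fun y => expR (- theta * spin0 y) * block_mgf q theta n y) x.
Proof.
rewrite /block_mgf iterS; congr (step q _ x); apply/funext => y.
rewrite -(iter_step_shift q _ (fun w => expR (- theta * spin0 w)));
  congr (iter _ _ _ y); apply/funext => z.
rewrite /spin_sum big_nat_recr//= mulrDr expRD; congr (_ * expR (_ * _)).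
rewrite /spin0; congr spin.
have -> k : iter n cshift z k = z (n + k)%N.
  by elim: n k => //= n IH k; rewrite /cshift IH addnS.
by rewrite addn0.
Qed.

(** The conditional mean, given the past x, of the sum of the next n spins. *)
Definition mean_sum q n x : R := \sum_(0 <= u < n) iter u.+1 (step q) spin0 x.

Lemma mean_sumS q n x :
  mean_sum q n.+1 x = step q (fun y => spin0 y + mean_sum q n y) x.
Proof.
have E u f : iter u (step q) (step q f) = step q (iter u (step q) f).
  by rewrite -iterSr.
rewrite /mean_sum big_nat_recl//=.
have -> : step q (fun y =>
  spin0 y + \sum_(0 <= u < n) step q (iter u (step q) spin0) y) x
   = step q spin0 x +
     step q (fun y => \sum_(0 <= u < n) step q (iter u (step q) spin0) y) x.
  by rewrite /step; ring.
congr (_ + _).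
elim: n => [|n IH]; first by rewrite /step !big_geq// !mulr0 addr0.
rewrite big_nat_recr//= IH /step !big_nat_recr//=; ring.
Qed.

Lemma spin0E : spin0 = (fun y => 2 * plus_spin y + -1).
Proof. by apply/funext => y; rewrite /spin0 /spin /plus_spin; case: (y _);
  rewrite /= ?mulr1n ?mulr0n; lra. Qed.

Lemma iter_step_spin0 q n x :
  iter n (step q) spin0 x = 2 * iter n (step q) plus_spin x - 1.
Proof. by rewrite spin0E iter_step_affine. Qed.

(** When one spin is revealed, the conditional mean of the block changes by at most
    2 C: each later spin u changes by at most 2 d u in the mean.  So the Doob
    martingale of the block sum has bounded differences. *)
Lemma block_mgf_le q (C theta : R) d n x : prob_valued q ->
  (forall u, osc_le (iter u (step q) plus_spin) (d u)) ->
  (forall n, \sum_(0 <= u < n) d u <= C) -> 0 <= theta -> 2 * theta * C <= 1 / 2 ->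
  block_mgf q theta n x <=
  expR (- theta * mean_sum q n x + n%:R * ((2 * theta * C) ^+ 2 / 3)).
Proof.
move=> hq hd hC th0 thC; elim: n x => [|n IH] x.
  by rewrite /block_mgf /spin_sum /mean_sum /= !big_geq// mulr0 mul0r addr0.
rewrite block_mgfS mean_sumS.
set K := (2 * theta * C) ^+ 2 / 3 in IH *.
pose W y := spin0 y + mean_sum q n y.
apply: (@le_trans _ _ (step q (fun y => expR (n%:R * K) * expR (- theta * W y)) x)).
  apply: step_le => // y; rewrite mulrC.
  apply: (le_trans (ler_wpM2r (expR_ge0 _) (IH y))).
  rewrite -!expRD ler_expR /W; lra.
have -> : step q (fun y => expR (n%:R * K) * expR (- theta * W y)) x
   = expR (n%:R * K) * (q x * expR (- theta * W (concat true x)) +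
        (1 - q x) * expR (- theta * W (concat false x))).
  by rewrite /step; ring.
set a := W (concat true x); set b := W (concat false x).
pose D := theta * (a - b).
have -> : - theta * a = - theta * step q W x + - (1 - q x) * D.
  by rewrite /step /D -/a -/b; ring.
have -> : - theta * b = - theta * step q W x + q x * D.
  by rewrite /step /D -/a -/b; ring.
(* D is theta times the jump of the conditional mean when the new spin is
   revealed. *)
have [D1 D2] : - (2 * theta * C) <= D /\ D <= 2 * theta * C.
  have WE y : W y = 2 * (\sum_(0 <= u < n.+1) iter u (step q) plus_spin y) - n.+1%:R.
    rewrite /W /mean_sum.
    rewrite -[spin0 y]/(iter 0 (step q) spin0 y) -(big_nat_recl n 0 (fun u =>
      iter u (step q) spin0 y))//.
    under eq_bigr do rewrite iter_step_spin0.
    by rewrite big_split/= -mulr_sumr sumrN sumr_const_nat subn0.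
  have key y z : W y - W z <= 2 * C.
    rewrite !WE.
    suff : \sum_(0 <= u < n.+1) iter u (step q) plus_spin y -
       \sum_(0 <= u < n.+1) iter u (step q) plus_spin z <= C by lra.
    rewrite -sumrB; apply: (le_trans _ (hC n.+1)); apply: ler_sum => u _.
    exact: hd.
  have k1 := key (concat true x) (concat false x).
  have k2 := key (concat false x) (concat true x).
  by rewrite /D /a /b; split; nra.
have hD : - (1 / 2) <= D <= 1 / 2 by lra.
have hm := two_point_mgf (hq x) hD.
have -> : expR (n%:R * K) *
    (q x * expR (- theta * step q W x + - (1 - q x) * D) +
     (1 - q x) * expR (- theta * step q W x + q x * D)) =
  expR (n%:R * K + - theta * step q W x) *
    (q x * expR (- (1 - q x) * D) + (1 - q x) * expR (q x * D)).
  by rewrite !expRD; ring.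
apply: (@le_trans _ _ (expR (n%:R * K + - theta * step q W x) * expR (D ^+ 2 / 3))).
  by rewrite ler_wpM2l// expR_ge0.
rewrite -expRD ler_expR /W.
suff : D ^+ 2 / 3 <= K by rewrite -natr1; lra.
rewrite /K; nra.
Qed.

(** The starting point x changes the mean of the block by at most 2 memory_cost, so
    a magnetization beta known from one start x1 suffices.  Markov's inequality for
    exp (- theta S) with theta = beta / (4 C^2) gives the exponent
    - 2 X + (2/3) X + beta / (2 C), and the last term is at most X / 3 since
    beta <= C and X >= 3/2. *)
Lemma block_sum_concentration (eps : R) q M x1 (beta : R) n :
  0 < eps < 1 / 2 -> elliptic eps q -> local M q -> 0 <= beta <= 1 ->
  (forall u, beta <= iter u.+1 (step q) spin0 x1) ->
  let X := n%:R * beta ^+ 2 / (8 * memory_cost eps M ^+ 2) in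
  3 / 2 <= X ->
  forall x, iter n (step q) (fun y => (spin_sum n y <= 0)%R%:R) x <= expR (- X).
Proof.
move=> heps hq ql hb hmean X hX x.
have hp := elliptic_prob_valued heps hq.
have [d [d0 hd dC]] := memory_decay heps hq ql.
have C1 := memory_cost_ge1 heps M; set C := memory_cost eps M in X hX dC C1 *.
pose theta := beta / (4 * C ^+ 2).
have C0 : C != 0 by rewrite gt_eqF//; lra.
have Ci : 0 <= C^-1 <= 1 by rewrite invr_ge0 invf_le1; lra.
have thE : 2 * theta * C = beta * C^-1 / 2 by rewrite /theta; field.
have bC : 0 <= beta * C^-1 <= 1 by nra.
have th0 : 0 <= theta.
  by rewrite /theta divr_ge0//; [lra | rewrite mulr_ge0// sqr_ge0].
apply: (@le_trans _ _ (block_mgf q theta n x)).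
  apply: iter_step_le => // y.
  case: (leP (spin_sum n y) 0) => hs; rewrite /= ?mulr1n ?mulr0n; last exact: expR_ge0. 
  apply: (le_trans _ (expR_ge1Dx _)); nra.
apply: (le_trans (block_mgf_le n x hp hd dC th0 _)); first by lra.
rewrite ler_expR.
have hV : n%:R * beta - 2 * C <= mean_sum q n x.
  apply: (@le_trans _ _ (\sum_(0 <= u < n) (beta - 2 * d u.+1))).
    rewrite big_split/= sumr_const_nat subn0 mulr_natl lerD2l sumrN -mulr_sumr lerN2.
    rewrite ler_wpM2l//; have := dC n.+1; rewrite big_nat_recl//; have := d0 0%N; lra.
  apply: ler_sum => u _.
  have := hmean u; have := hd u.+1 x1 x; rewrite !iter_step_spin0; lra.
have XE : X = n%:R * beta * theta / 2 by rewrite /X /theta; field.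
have KE : n%:R * ((2 * theta * C) ^+ 2 / 3) = 2 / 3 * X.
  by rewrite /X /theta; field.
rewrite KE.
have := ler_wpM2l th0 hV; lra.
Qed.

End Concentration.

(** * Comparison of chains, and magnetization by a field *)

Definition flip (x : config) : config := fun i => ~~ x i.
Definition all_plus : config := fun=> true.

Section Bias.
Context {R : realType}.
Implicit Types (q f g : config -> R) (x y : config).

Lemma iter_step_flip q f n x : (forall y, q (flip y) = 1 - q y) ->
  iter n (step q) f (flip x) = iter n (step q) (f \o flip) x.
Proof.
move=> qf; elim: n x => //= n IH x.
have E a : concat a (flip x) = flip (concat (~~ a) x).
  by apply/funext => -[|i]; rewrite /flip /= ?negbK.
by rewrite /step qf !E !IH /=; ring.
Qed.

Lemma config_le_all_plus x : config_le x all_plus.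
Proof. by move=> i; rewrite implybT. Qed.

Lemma spin0_increasing : increasing (@spin0 R).
Proof. by move=> x y /(_ 0%N); rewrite /spin0 /spin; case: (x _); case: (y _) => // _;
  lra. Qed.

Lemma plus_spin_increasing : increasing (@plus_spin R).
Proof.
by move=> x y /(_ 0%N); rewrite /plus_spin; case: (x _); case: (y _) => // _;
  rewrite ler_nat.
Qed.

Lemma spin_sum_increasing n : increasing (@spin_sum R n).
Proof.
move=> x y xy; apply: ler_sum => i _; have := xy i.
by rewrite /spin; case: (x _); case: (y _) => // _; lra.
Qed.

(** The all-plus configuration is the largest one, so a step away from it can only
    lower an increasing observable. *)
Lemma iter_step_all_plus_nonincr q f i n : prob_valued q -> increasing q ->
  increasing f ->
  iter (n + i) (step q) f all_plus <= iter i (step q) f all_plus.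
Proof.
move=> hq qi fi; elim: n => // n IH; rewrite addSn; apply: le_trans IH => /=.
set F := iter (n + i) (step q) f; have /andP[q0 q1] := hq all_plus.
have Fi : increasing F by exact: iter_step_increasing.
have h a : F (concat a all_plus) <= F all_plus by apply: Fi; exact: config_le_all_plus.
have := h true; have := h false; rewrite /step; nra.
Qed.

(** Telescoping: the two chains differ only through the steps at which one uses
    q' and the other q; the error made at a given step is e at the current
    configuration times what the q'-chain still remembers of one spin. *)
Lemma iter_step_compare q q' f (e : config -> R) d (E : R) n x :
  prob_valued q -> prob_valued q' -> increasing q' -> increasing f ->
  (forall y, 0 <= e y) -> (forall y, q' y - q y <= e y) ->
  (forall i, iter i (step q) e x <= E) ->
  (forall u, osc_le (iter u (step q') f) (d u)) ->
  iter n (step q') f x - iter n (step q) f x <= E * \sum_(0 <= u < n) d u.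
Proof.
move=> hq hq' qi fi e0 qe eE hd.
suff H i : iter i (step q) (fun y => iter n (step q') f y - iter n (step q) f y) x
   <= E * \sum_(0 <= u < n) d u by have := H 0%N.
elim: n i => [|n IH] i.
  rewrite big_geq// mulr0; apply: iter_step_le_cst => // y; by rewrite subrr.
set G' := iter n (step q') f in IH *; set G := iter n (step q) f in IH *.
apply: (@le_trans _ _ (iter i (step q) (fun y => d n * e y +
    step q (fun z => G' z - G z) y) x)).
  apply: iter_step_le => // y.
  rewrite !iterS -/G -/G'.
  have h1 := increasing_concat y (iter_step_increasing n hq' qi fi).
  have h2 := hd n (concat true y) (concat false y).
  rewrite -/G' in h1 h2; have := e0 y; have := qe y.
  rewrite /step; nra.
rewrite iter_stepD iter_stepZ -iterSr big_nat_recr//= mulrDr addrC.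
apply: lerD; first exact: (IH i.+1).
rewrite mulrC ler_wpM2r//.
by have := hd n x x; rewrite subrr.
Qed.

End Bias.

Section Heat.
Context {R : realType} (eps : R).
Hypothesis heps : 0 < eps < 1 / 2.
Implicit Types (b : config -> R) (x y : config).

(** The probability of a plus spin under a local field b in [-1, 1]. *)
Definition heat b x : R := 1 / 2 + (1 / 2 - eps) * b x.

Lemma heat_elliptic b : (forall x, -1 <= b x <= 1) -> elliptic eps (heat b).
Proof.
move=> hb x; have /andP[b0 b1] := hb x; have /andP[e0 e1] := heps.
have h0 : 0 <= (1 / 2 - eps) * (b x + 1) by rewrite mulr_ge0//; lra.
have h1 : 0 <= (1 / 2 - eps) * (1 - b x) by rewrite mulr_ge0//; lra.
by rewrite /heat; lra.
Qed.

Lemma heat_prob_valued b : (forall x, -1 <= b x <= 1) -> prob_valued (heat b).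
Proof. by move=> hb; exact: elliptic_prob_valued (heat_elliptic hb). Qed.

Lemma heat_increasing b : increasing b -> increasing (heat b).
Proof. by move=> bi x y xy; have := bi _ _ xy; have := heps; rewrite /heat; nra. Qed.

(** Adding a constant field to a symmetric attractive chain magnetizes it at
    least as much as the field acts on the last spin alone. *)
Lemma magnetization_ge_field b (delta : R) u : 0 <= delta ->
  (forall x, -1 <= b x <= 1) -> (forall x, -1 <= b x + delta <= 1) ->
  increasing b -> (forall x, b (flip x) = - b x) ->
  (1 - 2 * eps) * delta <=
  iter u.+1 (step (heat (fun x => b x + delta))) spin0 all_plus.
Proof.
move=> d0 hb hbd bi bodd.
pose q := heat (fun x => b x + delta).
have hq : prob_valued q by exact: heat_prob_valued.
have hq0 : prob_valued (heat b) by exact: heat_prob_valued.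
have qi : increasing (heat b) by exact: heat_increasing.
have q0q x : heat b x <= q x by have := heps; rewrite /heat /q /heat; nra.
rewrite -/q iterSr.
have -> : step q spin0 =
    (fun x => 1 * step (heat b) spin0 x + (1 - 2 * eps) * delta).
  by apply/funext => x; rewrite /step /q /heat /spin0 /=; field.
rewrite iter_step_affine mul1r lerDr.
apply: (@le_trans _ _ (iter u.+1 (step (heat b)) spin0 all_plus)).
  have h := config_le_all_plus (flip all_plus).
  have := iter_step_increasing u.+1 hq0 qi spin0_increasing h.
  rewrite iter_step_flip; last by move=> y; rewrite /heat bodd; field.
  have -> : spin0 \o flip = (fun x => -1 * spin0 x + 0) :> (config -> R).
    by apply/funext => x; rewrite /spin0 /spin /flip /=; case: (x _) => /=; lra.
  rewrite iter_step_affine; lra.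
rewrite iterSr.
apply: iter_step_le_drift => //.
exact: (iter_step_increasing 1 hq0 qi spin0_increasing).
Qed.

End Heat.

Section Majority.
Context {R : realType}.
Implicit Types (x y : config).

Definition majority_sign (n : nat) x : R := if 0 < spin_sum n x :> R then 1 else -1.

Lemma majority_sign_bound n x : -1 <= majority_sign n x <= 1.
Proof. by rewrite /majority_sign; case: ifP => _; lra. Qed.

Lemma majority_sign_increasing n : increasing (majority_sign n : config -> R).
Proof.
move=> x y /(@spin_sum_increasing R n); rewrite /majority_sign.
by case: (ltP 0 (spin_sum n x)); case: (ltP 0 (spin_sum n y)); lra.
Qed.

Lemma spin_sum_local n : local n (@spin_sum R n).
Proof. by move=> x y xy; apply: eq_big_nat => i /andP[_ ?]; rewrite xy. Qed.

Lemma majority_sign_local n : local n (majority_sign n : config -> R).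
Proof. by move=> x y /(@spin_sum_local n) xy; rewrite /majority_sign xy. Qed.

(** An odd number of spins has no tie. *)
Lemma spin_sum_neq0 n x : odd n -> spin_sum n x != 0 :> R.
Proof.
move=> on.
have E : spin_sum n x = 2 * (\sum_(0 <= i < n) x i)%:R - n%:R :> R.
  rewrite /spin_sum natr_sum; elim: n {on} => [|n IH].
    by rewrite !big_geq// mulr0 subr0.
  rewrite !big_nat_recr//= IH -natr1 /spin; case: (x n) => /=; rewrite ?mulr1n ?mulr0n;
    ring.
rewrite E subr_eq0 -natrM eqr_nat mul2n.
by apply: contraL on => /eqP <-; rewrite odd_double.
Qed.

Lemma spin_sum_flip n x : spin_sum n (flip x) = - spin_sum n x :> R.
Proof.
rewrite /spin_sum -sumrN; apply: eq_bigr => i _.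
by rewrite /spin /flip; case: (x i) => /=; rewrite ?opprK.
Qed.

Lemma majority_sign_flip n x : odd n ->
  majority_sign n (flip x) = - majority_sign n x.
Proof.
move=> on; rewrite /majority_sign spin_sum_flip oppr_gt0.
by have := spin_sum_neq0 x on; case: ltgtP => // _ _; rewrite opprK.
Qed.

End Majority.

(** * Local sets and invariant functionals *)

Definition cylinder (n : nat) (x : config) : set config :=
  [set y | forall i, (i < n)%N -> y i = x i].

Lemma nbhs_cylinder (n : nat) (x : config) : nbhs x (cylinder n x).
Proof.
elim: n => [|n IH]; first by apply: filterS filterT.
have h : nbhs x [set y : config | y n = x n].
  apply: (@proj_continuous nat (fun=> bool) n x [set x n]).
  exact: discrete_set1.
apply: filterS (filterI IH h) => y [h1 h2] i; rewrite ltnS leq_eqVlt.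
by move=> /orP[/eqP->//|]; exact: h1.
Qed.

Lemma cylinder_basis (x : config) (U : set config) : nbhs x U ->
  exists n, cylinder n x `<=` U.
Proof.
pose F := filter_from [set: nat] (cylinder ^~ x).
have FF : Filter F.
  apply: filter_from_filter; first by exists 0%N.
  move=> i j _ _; exists (maxn i j) => // y h; split => k hk; apply: h.
    by rewrite (leq_trans hk)// leq_maxl.
  by rewrite (leq_trans hk)// leq_maxr.
suff Fx : F --> x by move=> /Fx [n _ h]; exists n.
have projT i : proj i @` [set: config] = [set: bool].
  by apply/seteqP; split => // b _; exists (fun=> b).
apply/cvg_sup => i; apply/cvg_image; first exact: projT.
move=> A /= /nbhs_singleton Ax.
exists (proj i @^-1` A); last by rewrite image_preimage.
exists i.+1 => // y h /=.
by rewrite /proj (h i).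
Qed.

Lemma local_preimage {T} n (f : config -> T) (A : set T) :
  local n f -> local n (f @^-1` A).
Proof. by move=> fl x y xy; rewrite /preimage /mkset (fl _ _ xy). Qed.

Lemma local_open n (A : set config) : local n A -> open A.
Proof.
move=> Al; rewrite openE => x Ax; apply: filterS (nbhs_cylinder n x) => y xy.
by rewrite (Al y x).
Qed.

Lemma localC n (A : set config) : local n A -> local n (~` A).
Proof. by move=> Al x y xy; rewrite /setC /mkset (Al _ _ xy). Qed.

Lemma local_closed n (A : set config) : local n A -> closed A.
Proof. by move=> /localC /local_open; rewrite -closedC setCK. Qed.

Lemma local_map2 {T1 T2 T} (h : T1 -> T2 -> T) n1 n2 (f1 : config -> T1) (f2 :
  config -> T2) :
  local n1 f1 -> local n2 f2 -> local (maxn n1 n2) (fun x => h (f1 x) (f2 x)).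
Proof.
move=> l1 l2 x y xy; congr h.
  by apply: (localW (leq_maxl _ _) l1) xy.
by apply: (localW (leq_maxr _ _) l2) xy.
Qed.

Definition is_local {T} (f : config -> T) := exists n, local n f.

Definition local_sets : set_system config := [set A | is_local A].

Lemma open_bigcup_local (U : set config) : open U ->
  U = \bigcup_n [set x | cylinder n x `<=` U].
Proof.
rewrite openE => oU; rewrite eqEsubset; split => x.
  by move=> /oU /cylinder_basis [n xU]; exists n.
by move=> [n _]; apply.
Qed.

Lemma sigma_open_local : <<s @open config >> = <<s local_sets >>.
Proof.
rewrite eqEsubset; split.
  apply: smallest_sub; first exact: smallest_sigma_algebra.
  move=> U /open_bigcup_local ->; apply: sigma_algebra_bigcup => n.
  apply: sub_sigma_algebra; exists n => x y xy; rewrite /mkset.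
  congr (_ `<=` _); rewrite /cylinder; apply/seteqP; split => z h i ni.
    by rewrite h// xy.
  by rewrite h// xy.
apply: smallest_sub; first exact: smallest_sigma_algebra.
by move=> A [n /local_open oA]; exact: sub_sigma_algebra.
Qed.

Lemma local_measurable (A : set config) : is_local A -> measurable (A :
  set borel_config).
Proof. by move=> [n /local_open oA]; exact: sub_sigma_algebra. Qed.

(** The union is closed, hence compact, and the terms of the union are open, so
    finitely many of them cover it; by disjointness the others are empty. *)
Lemma local_disjoint_finite (F : (set config)^nat) :
  (forall i, is_local (F i)) -> trivIset setT F -> is_local (\bigcup_i F i) ->
  exists N, forall i, (N <= i)%N -> F i = set0.
Proof.
move=> Fl tF [n Ul].
have cU : compact (\bigcup_i F i).
  apply: subclosed_compact cantor_space_compact _ => //; exact: local_closed Ul.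
move: cU; rewrite compact_cover => /(_ nat setT F) [].
- by move=> i _; have [k] := Fl i; exact: local_open.
- by [].
move=> D _ UD; exists (\max_(i <- finmap.enum_fset D) i).+1 => i hi.
rewrite -subset0 => x Fx.
have [j Dj Fjx] := UD x (ex_intro2 _ _ i I Fx).
have E : i = j by apply: (tF i j) => //; exists x.
have : (j <= \max_(i <- finmap.enum_fset D) i)%N.
  by apply: (@leq_bigmax_seq _ _ xpredT id).
by rewrite -E leqNgt hi.
Qed.

Section Limit.
Context {R : realType}.

(** An ultrafilter gives a limit to all bounded sequences at once, hence a limit
    functional on all bounded observables. *)
Lemma ultra_cvg_bounded (U : set_system nat) (u : nat -> R) (M : R) :
  UltraFilter U -> (forall n, `|u n| <= M) -> cvg (u @ U).
Proof.
move=> UU uM.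
have FU : UltraFilter (u @ U).
  split; first exact: fmap_proper_filter.
  move=> G PG sG; rewrite eqEsubset; split => // A GA.
  have [//|nA] := in_ultra_setVsetC (u @^-1` A) UU.
  have GnA : G (~` A) by apply: sG.
  by have [x [? ?]] := @filter_ex _ _ PG _ (filterI GA GnA).
have := @segment_compact R (- M) M; rewrite compact_ultra => /(_ (u @ U) FU) [].
  have : U (u @^-1` `[- M, M]) by apply: filterE => n /=; rewrite in_itv/= -ler_norml.
  exact.
by move=> l [_ ul]; apply/cvg_ex; exists l.
Qed.

Definition bounded_obs (f : config -> R) := exists M, forall x, `|f x| <= M.

Record positive_functional (L : (config -> R) -> R) : Prop := {
  functionalD : forall f g, bounded_obs f -> bounded_obs g ->
     L (fun x => f x + g x) = L f + L g;
  functionalZ : forall c f, bounded_obs f -> L (fun x => c * f x) = c * L f;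
  functional_ge0 : forall f, bounded_obs f -> (forall x, 0 <= f x) -> 0 <= L f;
  functional1 : L (fun=> 1) = 1 }.

Variables (q : config -> R) (x0 : config).
Hypothesis hq : prob_valued q.

Let cesaro n (f : config -> R) : R :=
  n.+1%:R^-1 * \sum_(0 <= i < n.+1) iter i (step q) f x0.

Lemma iter_step_norm_le f M n x : (forall y, `|f y| <= M) ->
  `|iter n (step q) f x| <= M.
Proof.
move=> fM; rewrite ler_norml iter_step_ge_cst ?iter_step_le_cst//.
  by move=> y; have := fM y; rewrite ler_norml => /andP[].
by move=> y; have := fM y; rewrite ler_norml => /andP[].
Qed.

Let cesaro_bound f M n : (forall x, `|f x| <= M) -> `|cesaro n f| <= M.
Proof.
move=> fM; rewrite /cesaro normrM normfV normr_nat ler_pdivrMl ?ltr0n//.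
apply: (le_trans (ler_norm_sum _ _ _)).
apply: (@le_trans _ _ (\sum_(0 <= i < n.+1) M)).
  by apply: ler_sum => i _; exact: iter_step_norm_le.
by rewrite sumr_const_nat subn0 mulr_natl.
Qed.

(** The Krylov-Bogoliubov argument: the Cesaro averages of the laws of the chain
    started from x0 are invariant up to a term of order 1 / n, and a limit along an
    ultrafilter replaces a convergent subsequence. *)
Lemma stationary_functional : exists L : (config -> R) -> R,
  [/\ positive_functional L,
      forall f, bounded_obs f -> L (step q f) = L f &
      forall f c, bounded_obs f -> (forall n, c <= iter n (step q) f x0) -> c <= L f].
Proof.
have [U [UU ooU]] := @ultraFilterLemma nat \oo _.
pose L f := lim (cesaro ^~ f @ U).
have Lc f : bounded_obs f -> cesaro ^~ f @ U --> L f.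
  move=> [M fM]; apply: (@ultra_cvg_bounded U _ M) => n.
  exact: cesaro_bound.
have Lge f c : bounded_obs f -> (forall n, c <= iter n (step q) f x0) -> c <= L f.
  move=> bf cf; apply: (cvgr_to_ge (Lc _ bf)); apply: filterE => n.
  rewrite /cesaro ler_pdivlMl ?ltr0n// -(subn0 n.+1) mulr_natl -sumr_const_nat.
  exact: ler_sum.
exists L; split => //.
- split.
  + move=> f g bf bg; apply: cvg_lim => //.
    have -> : cesaro ^~ (fun x => f x + g x) = (fun n => cesaro n f + cesaro n g).
      apply/funext => n; rewrite /cesaro -mulrDr -big_split/=; congr (_ * _).
      by apply: eq_bigr => i _; rewrite iter_stepD.
    by apply: cvgD; exact: Lc.
  + move=> c f bf; apply: cvg_lim => //.
    have -> : cesaro ^~ (fun x => c * f x) = (fun n => c * cesaro n f).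
      apply/funext => n; rewrite /cesaro mulrCA; congr (_ * _); rewrite mulr_sumr.
      by apply: eq_bigr => i _; rewrite iter_stepZ.
    by apply: cvgMl_tmp; exact: Lc.
  + by move=> f bf f0; apply: Lge => // n; exact: iter_step_ge_cst.
  + apply: cvg_lim => //.
    have -> : cesaro ^~ (fun=> 1) = (fun=> 1).
      apply/funext => n; rewrite /cesaro.
      under eq_bigr do rewrite iter_step_cst.
      by rewrite sumr_const_nat subn0 mulVf// pnatr_eq0.
    exact: cvg_cst.
- move=> f bf; apply: cvg_lim => //.
  have [M fM] := bf.
  have -> : cesaro ^~ (step q f) =
     (fun n => cesaro n f + n.+1%:R^-1 * (iter n.+1 (step q) f x0 - f x0)).
    apply/funext => n; rewrite /cesaro -mulrDr; congr (_ * _).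
    under eq_bigr do rewrite -iterSr.
    rewrite [in RHS]big_nat_recl//= [in LHS]big_nat_recr//=; ring.
  rewrite -[X in _ --> X]addr0; apply: cvgD; first exact: Lc.
  suff h : (fun n => n.+1%:R^-1 * (iter n.+1 (step q) f x0 - f x0)) @ \oo --> (0 : R).
    by move=> A /h /ooU.
  have hc c : (fun n => c * harmonic n) @ \oo --> (0 : R).
    by rewrite -(mulr0 c); apply: cvgMl_tmp; exact: cvg_harmonic.
  apply: (squeeze_cvgr _ (hc (- (2 * M))) (hc (2 * M))).
  apply: nearW => n; rewrite [in X in _ <= X <= _]mulrC /harmonic /=.
  have h1 := fM x0; have h2 := iter_step_norm_le n.+1 x0 fM.
  move: h1 h2; rewrite !ler_norml /= => h1 h2.
  by rewrite !ler_wpM2r ?invr_ge0//; lra.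
Unshelve. all: by typeclasses eauto. Qed.

End Limit.

(** * From functionals to measures *)

(** A copy of the configuration space carrying the algebra of local sets, on
    which the content to be extended is defined. *)
Definition local_config : Type := config.

Fact local_display : measure_display. Proof. exact: default_measure_display. Qed.

Lemma local_sets0 : local_sets set0.
Proof. by exists 0%N. Qed.

Lemma local_setsU : setU_closed local_sets.
Proof.
move=> A B [n An] [k Bk]; exists (maxn n k).
exact: (local_map2 or An Bk).
Qed.

Lemma local_setsC : setC_closed local_sets.
Proof. by move=> A [n An]; exists n; exact: localC. Qed.

Lemma local_setsI : setI_closed local_sets.
Proof.
move=> A B [n An] [k Bk]; exists (maxn n k).
exact: (local_map2 and An Bk).
Qed.

HB.instance Definition _ := Pointed.on local_config.
HB.instance Definition _ := @isAlgebraOfSets.Build local_display local_config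
  local_sets local_sets0 local_setsU local_setsC.

Section Extension.
Context {R : realType} (L : (config -> R) -> R).
Hypothesis HL : positive_functional L.

Lemma bounded_obs_cst (c : R) : bounded_obs (fun=> c).
Proof. by exists `|c|. Qed.

Lemma bounded_obs_indic (A : set config) : bounded_obs (\1_A : config -> R).
Proof.
by exists 1 => x; rewrite indicE; case: (x \in A); rewrite ?normr0 ?normr1.
Qed.

Lemma bounded_obsD (f g : config -> R) : bounded_obs f -> bounded_obs g ->
  bounded_obs (fun x => f x + g x).
Proof.
move=> [M fM] [N gN]; exists (M + N) => x.
by rewrite (le_trans (ler_normD _ _))// lerD.
Qed.

Lemma bounded_obsM (f g : config -> R) : bounded_obs f -> bounded_obs g ->
  bounded_obs (fun x => f x * g x).
Proof.
move=> [M fM] [N gN]; exists (M * N) => x.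
by rewrite normrM ler_pM.
Qed.

Lemma functional0 : L (fun=> 0) = 0.
Proof.
rewrite -[RHS](mul0r (L (fun=> 1))) -(functionalZ HL 0 (bounded_obs_cst 1)).
by congr L; apply/funext => x; rewrite mul0r.
Qed.

Lemma functional_le f g : bounded_obs f -> bounded_obs g ->
  (forall x, f x <= g x) -> L f <= L g.
Proof.
move=> bf bg fg.
have bNf : bounded_obs (fun x => -1 * f x) by exact:
  bounded_obsM (bounded_obs_cst _) bf.
rewrite -subr_ge0.
have -> : L g - L f = L (fun x => g x + -1 * f x).
  by rewrite (functionalD HL)// (functionalZ HL)// mulN1r.
apply: (functional_ge0 HL); first exact: bounded_obsD.
by move=> x; rewrite mulN1r subr_ge0.
Qed.

Lemma functional_cst c : L (fun=> c) = c.
Proof.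
rewrite -[RHS]mulr1 -(functional1 HL) -(functionalZ HL c (bounded_obs_cst 1)).
by congr L; apply/funext => x; rewrite mulr1.
Qed.

Definition local_content (A : set local_config) : \bar R := (L \1_A)%:E.

Let local_content0 : local_content set0 = 0%E.
Proof. by rewrite /local_content indic0 functional0. Qed.

Let local_content_ge0 A : (0 <= local_content A)%E.
Proof.
rewrite lee_fin; apply: (functional_ge0 HL); first exact: bounded_obs_indic.
by move=> x; rewrite indicE.
Qed.

Let local_contentU (A B : set local_config) : A `&` B = set0 ->
  local_content (A `|` B) = (local_content A + local_content B)%E.
Proof.
move=> AB; rewrite /local_content -EFinD; congr (_%:E).
rewrite -(functionalD HL); try exact: bounded_obs_indic.
congr L; apply/funext => x; rewrite !indicE in_setU.
have [xA|xA] := boolP (x \in A); have [xB|xB] := boolP (x \in B);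
 rewrite /= ?mulr1n ?mulr0n ?addr0 ?add0r//.
have : (A `&` B) x by split; exact/set_mem.
by rewrite AB.
Qed.

Let local_content_bigcup (F : (set local_config)^nat) N : trivIset setT F ->
  local_content (\bigcup_(i < N) F i) = (\sum_(0 <= i < N) local_content (F i))%E.
Proof.
move=> tF; elim: N => [|N IH].
  rewrite big_geq// -local_content0; congr local_content.
  by rewrite -subset0 => x [].
rewrite big_nat_recr//= -IH -local_contentU.
  congr local_content; apply/seteqP; split => x.
    move=> [i /=]; rewrite ltnS leq_eqVlt => /orP[/eqP->|iN] Fx; first by right.
    by left; exists i.
  move=> [[i /= iN Fx]|Fx]; [exists i => //=|exists N => //=].
  exact: ltnW.
rewrite -subset0 => x [[i /= iN Fix] FNx].
have E : i = N by apply: (tF i N) => //; exists x.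
by rewrite E ltnn in iN.
Qed.

Let local_content_sigma_additive : semi_sigma_additive local_content.
Proof.
move=> F mF tF mU.
have [N F0] := local_disjoint_finite mF tF mU.
have -> : \bigcup_n F n = \bigcup_(i < N) F i.
  apply/seteqP; split => x [i _ Fx]; exists i => //=.
  by rewrite ltnNge; apply/negP => /F0 E; rewrite E in Fx.
rewrite local_content_bigcup//.
apply: cvg_near_cst; near=> n.
have Nn : (N <= n)%N by near: n; exact: nbhs_infty_ge.
rewrite (@big_cat_nat _ _ _ N 0 n)//= [X in (_ + X)%E](_ : _ = 0%E) ?adde0//.
by rewrite big_nat big1// => i /andP[Ni _]; rewrite F0// local_content0.
Unshelve. all: by end_near. Qed.

HB.instance Definition _ := isMeasure.Build local_display local_config R local_content
  local_content0 local_content_ge0 local_content_sigma_additive.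

Let mu_ext : set borel_config -> \bar R := measure_extension local_content.

Let mu0 : mu_ext set0 = 0%E. Proof. exact: measure0. Qed.
Let mu_ge0 A : (0 <= mu_ext A)%E. Proof. exact: measure_ge0. Qed.

Let mu_sigma_additive : semi_sigma_additive mu_ext.
Proof.
have E (A : set borel_config) : measurable A ->
    @measurable _ (g_sigma_algebraType (@measurable _ local_config)) A.
  by rewrite /measurable /= sigma_open_local.
move=> F mF tF mU.
apply: (@measure_semi_sigma_additive _ _ _ (measure_extension local_content)) => //.
  by move=> i; exact: E.
exact: E.
Qed.

(** On local sets the functional is a finitely additive content; it is
    automatically sigma-additive there, by compactness, and so it extends to the
    Borel sets. *)
Lemma measure_of_functional : exists mu : probability borel_config R,
  forall A, is_local A -> mu A = (L \1_A)%:E.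
Proof.
have muE A : is_local A -> mu_ext A = (L \1_A)%:E.
  by move=> Al; rewrite /mu_ext /measure_extension measurable_mu_extE.
have mu1 : mu_ext setT = 1%E.
  by rewrite muE ?indicT ?functional_cst//; exists 0%N.
pose m0 := isMeasure.Build _ borel_config R mu_ext mu0 mu_ge0 mu_sigma_additive.
pose mu : {measure set borel_config -> \bar R} := HB.pack mu_ext m0.
pose p0 := Measure_isProbability.Build _ _ _ mu mu1.
pose P : probability borel_config R := HB.pack mu_ext m0 p0.
by exists P.
Qed.

End Extension.

(** * Integrals of uniformly local functions *)

Section UniformlyLocal.
Context {R : realType}.
Implicit Types (f g : config -> R) (x y : config).

(** On the configuration space these are the continuous functions. *)
Definition uniformly_local f := forall e : R, 0 < e ->
  exists2 g : config -> R, is_local g & forall x, `|f x - g x| <= e.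

Lemma uniformly_local_continuous f : uniformly_local f -> continuous f.
Proof.
move=> fu x; apply/cvgrPdist_le => e e0.
have e20 : 0 < e / 2 by rewrite divr_gt0.
have [g [n gl] fg] := fu _ e20.
apply: filterS (nbhs_cylinder n x) => y xy.
have := fg x; have := fg y; rewrite (gl y x)// !ler_norml; lra.
Qed.

Lemma local_measurable_fun d (T : measurableType d) (f : config -> T) : is_local f ->
  measurable_fun setT (f : borel_config -> T).
Proof.
move=> [n fl] _ Y mY; rewrite setTI; apply: local_measurable; exists n.
exact: local_preimage.
Qed.

Lemma uniformly_local_measurable f : uniformly_local f ->
  measurable_fun setT (f : borel_config -> R).
Proof.
move=> fu.
have [h hl] : {h : nat -> config -> R & forall n, is_local (h n) /\
    forall x, `|f x - h n x| <= n.+1%:R^-1}.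
  apply: (@choice _ _ (fun n hn => is_local hn /\ forall x, `|f x - hn x|
    <= n.+1%:R^-1)).
  by move=> n; have [|g ? ?] := fu (n.+1%:R^-1); [rewrite invr_gt0|exists g].
apply: ((@measurable_fun_cvg _ borel_config R setT h f)).
  by move=> n; apply: local_measurable_fun; have [] := hl n.
move=> x _; apply/cvgrPdist_le => e e0.
have := @cvg_harmonic R; move=> /cvgrPdist_le /(_ e e0) [N _ hN].
exists N => // n /hN; rewrite sub0r normrN ger0_norm /harmonic /= => [h1|];
  last by rewrite invr_ge0.
by have [_ /(_ x)] := hl n => h2; exact: le_trans h1.
Qed.

Lemma local_shift {T} n (f : config -> T) : local n f -> local n.+1 (f \o cshift).
Proof. by move=> fl x y xy; apply: fl => i ni; rewrite /cshift xy. Qed.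

Lemma uniformly_local_shift f : uniformly_local f -> uniformly_local (f \o cshift).
Proof.
move=> fu e /fu [g [n gl] fg]; exists (g \o cshift); last by move=> x; exact: fg.
by exists n.+1; exact: local_shift.
Qed.

End UniformlyLocal.

Section Integral.
Context {R : realType} (L : (config -> R) -> R).
Hypothesis HL : positive_functional L.
Variable mu : probability borel_config R.
Hypothesis muL : forall A, is_local A -> mu A = (L \1_A)%:E.
Implicit Types (f g : config -> R) (x y : config).

Lemma bounded_obs_integrable f (A : set borel_config) : measurable A ->
  bounded_obs f -> measurable_fun setT (f : borel_config -> R) ->
  mu.-integrable A (EFin \o f).
Proof.
move=> mA [M fM] mf; apply: measurable_bounded_integrable => //.
- by apply: le_lt_trans (ltry 1); exact: probability_le1.
- exact: measurable_funTS.
- exists M; split; first exact: num_real.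
  by move=> N MN x _; apply: le_trans (ltW MN); exact: fM.
Qed.

(** Induction on the number of coordinates: the last coordinate is fixed to each of
    its two values, on which A is split accordingly. *)
Lemma integral_local n f (A : set config) : local n f -> bounded_obs f -> is_local A ->
  \int[mu]_(x in (A : set borel_config)) f x = L (fun x => f x * \1_A x).
Proof.
elim: n f A => [|n IH] f A fl bf Al.
  have fE x : f x = f point by exact: fl.
  have -> : f = (fun=> f point) by exact/funext.
  rewrite Rintegral_cst; last exact: local_measurable.
  rewrite (functionalZ HL); last exact: bounded_obs_indic.
  by congr (_ * _); exact: (congr1 fine (muL Al)).
pose upd (b : bool) x : config := fun i => if i == n then b else x i.
pose A_ (b : bool) := A `&` [set x : config | x n = b].
pose f_ b := f \o upd b.
have fbl b : local n (f_ b).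
  move=> x y xy; apply: fl => i; rewrite ltnS leq_eqVlt /upd.
  by case: eqP => //= _ ; exact: xy.
have fE b x : x n = b -> f_ b x = f x.
  move=> xn; rewrite /f_ /=; congr f; apply/funext => i; rewrite /upd.
  by case: eqP => // ->.
have bfb b : bounded_obs (f_ b) by have [M fM] := bf; exists M => x; exact: fM.
have Abl b : is_local (A_ b).
  apply: local_setsI => //; exists n.+1 => x y xy.
  by rewrite /mkset xy.
have AE : A = A_ true `|` A_ false.
  apply/seteqP; split => x; last by move=> [[]|[]].
  by move=> Ax; case E : (x n); [left|right].
have mb b : measurable (A_ b : set borel_config) by exact: local_measurable.
rewrite [in LHS]AE Rintegral_setU//; last first.
- by rewrite disj_set2E; apply/eqP; rewrite -subset0 => x [[_ /= h1] [_ /=]];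
  rewrite h1.
- apply: bounded_obs_integrable => //; first exact: measurableU.
  by apply: local_measurable_fun; exists n.+1.
have intE b : \int[mu]_(x in (A_ b : set borel_config)) f x = L (fun x =>
  f_ b x * \1_(A_ b) x).
  rewrite -IH//; apply: eq_Rintegral => x /set_mem[_ /= xb].
  by rewrite fE.
rewrite !intE -(functionalD HL); try by apply: bounded_obsM => //;
  exact: bounded_obs_indic.
congr L; apply/funext => x; rewrite !indicE !in_setI.
have [xA|xA] := boolP (x \in A); rewrite /= ?mulr0 ?addr0//.
case E : (x n); rewrite ?(fE _ _ E).
  by rewrite (mem_set (_ : [set x0 | x0 n = true] x))// memNset ?mulr0 ?addr0//= E.
by rewrite (mem_set (_ : [set x0 | x0 n = false] x))// memNset ?mulr0 ?add0r//= E.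
Qed.

Lemma integral_uniformly_local f (A : set config) : uniformly_local f ->
  bounded_obs f -> is_local A ->
  \int[mu]_(x in (A : set borel_config)) f x = L (fun x => f x * \1_A x).
Proof.
move=> fu bf Al.
have mA := local_measurable Al.
have bA := @bounded_obs_indic R A.
apply/eqP; rewrite -subr_eq0 -normr_le0; apply/ler_addgt0Pl => e e0; rewrite addr0.
have e20 : 0 < e / 2 by rewrite divr_gt0.
have [g gl fg] := fu _ e20; have [n gn] := gl.
have bg : bounded_obs g.
  have [M fM] := bf; exists (M + e / 2) => x.
  have := fM x; have := fg x; rewrite !ler_norml; lra.
have mf := uniformly_local_measurable fu.
have mg := local_measurable_fun gl.
have int_f := bounded_obs_integrable mA bf mf.
have int_g := bounded_obs_integrable mA bg mg.
have bfg : bounded_obs (fun x => `|f x - g x|) by exists (e / 2) => x; rewrite normr_id.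
have mfg : measurable_fun setT ((fun x => f x - g x) : borel_config -> R).
  exact: measurable_funB.
have d1 : `|\int[mu]_(x in (A : set borel_config)) f x -
    \int[mu]_(x in (A : set borel_config)) g x| <= e / 2.
  rewrite -RintegralB//; apply: (le_trans (le_normr_Rintegral _ _)) => //.
    by apply: bounded_obs_integrable => //; exists (e / 2).
  apply: (@le_trans _ _ (\int[mu]_(x in (A : set borel_config)) (e / 2))).
    apply: le_Rintegral => //.
      apply: bounded_obs_integrable => //.
      exact: measurableT_comp.
    by apply: bounded_obs_integrable => //; exact: bounded_obs_cst.
  rewrite Rintegral_cst// ler_piMr//; first exact: ltW.
  by rewrite -lee_fin fineK ?probability_le1// fin_num_measure.
have d2 : `|L (fun x => f x * \1_A x) - L (fun x => g x * \1_A x)| <= e / 2.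
  have key h k : bounded_obs h -> bounded_obs k -> (forall x, `|h x - k x| <= e / 2) ->
     L (fun x => h x * \1_A x) <= L (fun x => k x * \1_A x) + e / 2.
    move=> bh bk hk; rewrite -[e / 2 in leRHS](functional_cst HL).
    rewrite -(functionalD HL); [|exact: bounded_obsM|exact: bounded_obs_cst].
    apply: (functional_le HL).
    - exact: bounded_obsM.
    - by apply: bounded_obsD; [exact: bounded_obsM|exact: bounded_obs_cst].
    - move=> x; have := hk x; rewrite ler_norml indicE.
      by case: (x \in A); rewrite /= ?mulr1n ?mulr0n; lra.
  have k1 := key f g bf bg fg.
  have k2 := key g f bg bf (fun x => eq_ind _ (fun z =>
    z <= e / 2) (fg x) _ (distrC _ _)).
  rewrite ler_norml; lra.
move: d1 d2; rewrite (integral_local gn bg Al) !ler_norml; lra.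
Qed.

End Integral.

(** * Existence of g-measures *)

Lemma cshift_measurable : measurable_fun setT (cshift : borel_config -> borel_config).
Proof.
apply: (@measurability _ _ borel_config borel_config setT cshift local_sets);
  first exact: sigma_open_local.
move=> _ [A [n An] <-]; rewrite setTI; apply: local_measurable; exists n.+1.
exact: (local_shift An).
Qed.

Section GMeasureExistence.
Context {R : realType}.

Definition finite_measure (m : set borel_config -> \bar R) :=
  [/\ m set0 = 0%E, forall A, (0 <= m A)%E, semi_sigma_additive m & (m setT < +oo)%E].

Lemma finite_measure_cshift m : finite_measure m ->
  finite_measure (fun B => m (cshift @^-1` B)).
Proof.
move=> [m0 mge0 madd mfin]; split => //.
move=> F mF tF mUF; rewrite preimage_bigcup.
have mc (B : set borel_config) : measurable B ->
    measurable (cshift @^-1` B : set borel_config).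
  by move=> mB; rewrite -[X in measurable X]setTI; exact: cshift_measurable.
apply: madd.
- by move=> i; exact: mc.
- apply/trivIsetP => /= i j _ _ ij; rewrite -preimage_setI.
  by move/trivIsetP : tF => /(_ _ _ _ _ ij) ->//; rewrite preimage_set0.
- by rewrite -preimage_bigcup; exact: mc.
Qed.

Lemma measure_eq_of_local m1 m2 : finite_measure m1 -> finite_measure m2 ->
  (forall A, is_local A -> m1 A = m2 A) ->
  forall B, measurable B -> m1 B = m2 B.
Proof.
move=> [m10 m1ge0 m1add m1fin] [m20 m2ge0 m2add m2fin] m12 B mB.
pose M1 : {measure set borel_config -> \bar R} :=
  HB.pack m1 (isMeasure.Build _ borel_config R m1 m10 m1ge0 m1add).
pose M2 : {measure set borel_config -> \bar R} :=
  HB.pack m2 (isMeasure.Build _ borel_config R m2 m20 m2ge0 m2add).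
apply: (@measure_unique _ R borel_config local_sets (fun=> setT) _ _ _ _ M1 M2) => //.
- exact: sigma_open_local.
- exact: local_setsI.
- by move=> _; exists 0%N.
- by rewrite bigcup_const//; exists 0%N.
Qed.

Lemma finite_measure_probability (mu : probability borel_config R) (D :
  set borel_config) :
  measurable D -> finite_measure (fun B => mu (D `&` B)).
Proof.
move=> mD; split => //.
- by rewrite setI0 measure0.
- move=> F mF tF mUF; rewrite setI_bigcupr; apply: measure_semi_sigma_additive.
  + by move=> i; exact: measurableI.
  + exact: trivIset_setIl.
  + by rewrite -setI_bigcupr; exact: measurableI.
- by apply: le_lt_trans (ltry 1); rewrite probability_le1// setIT.
Qed.

Variables (g : config -> R) (x0 : config).
Hypothesis gg : g_function g.

Let q x := g (concat true x).
Hypothesis qu : uniformly_local q.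

Let q_prob_valued : prob_valued q.
Proof. by move=> x; have [_ /(_ (concat true x)) /andP[? ?] _] := gg; rewrite !ltW. Qed.

Let g_false x : g (concat false x) = 1 - q x.
Proof. by have [_ _ /(_ x)] := gg; rewrite big_bool /= => h;
  rewrite /q -h addrAC subrr add0r. Qed.

Let phi a x := g (concat a x).

Let phi01 a x : 0 <= phi a x <= 1.
Proof.
by have [_ /(_ (concat a x)) /andP[? ?] _] := gg; rewrite !ltW.
Qed.

Let phi_bounded a : bounded_obs (phi a).
Proof. by exists 1 => x; have /andP[? ?] := phi01 a x; rewrite ger0_norm. Qed.

Let phi_uniformly_local a : uniformly_local (phi a).
Proof.
case: a => // e /qu [h [n hl] qh]; exists (fun x => 1 - h x).
  by exists n => x y xy; rewrite (hl _ _ xy).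
move=> x; rewrite /phi g_false.
have -> : 1 - q x - (1 - h x) = h x - q x by ring.
by rewrite distrC.
Qed.

Let step_shift f : step q (f \o cshift) = f.
Proof.
apply/funext => x; rewrite /step /=.
have -> a : cshift (concat a x) = x by apply/funext.
ring.
Qed.

(** The extension of a functional invariant under the one-step operator is a
    g-measure: one step applied to an observable of the shifted configuration gives
    that observable back, which is shift invariance, and one step applied to the
    event that the last spin is a weights it by g, which is the conditional
    probability.  Both identities hold on local sets and extend to Borel sets by
    uniqueness.  Lower bounds along the chain from x0 pass to the measure. *)
Lemma g_measure_exists : exists mu : probability borel_config R,
  g_measure g mu /\
  forall (A : set config) (c : R), is_local A ->
    (forall n, c <= iter n (step q) \1_A x0) -> (c%:E <= mu A)%E.
Proof.
have [L [HL Linv Lge]] := stationary_functional x0 q_prob_valued.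
have [mu muL] := measure_of_functional HL.
exists mu; split; last first.
  by move=> A c Al cA; rewrite muL// lee_fin; apply: Lge => //;
    exact: bounded_obs_indic.
have indic_shift (A : set config) : \1_(cshift @^-1` A) =
  (\1_A \o cshift) :> (config -> R).
  by apply/funext => x; rewrite !indicE.
have local_cshift (A : set config) : is_local A -> is_local (cshift @^-1` A).
  by move=> [n Al]; exists n.+1; exact: (local_shift Al).
split => //.
  move=> B mB.
  have fmu : finite_measure mu.
    by split => //; [exact: measure_semi_sigma_additive |
      rewrite probability_setT ltry].
  apply: (measure_eq_of_local (finite_measure_cshift fmu) fmu) mB => A Al.
  rewrite muL ?muL//; last exact: local_cshift.
  rewrite -(Linv \1_(cshift @^-1` A)); last exact: bounded_obs_indic.
  by rewrite indic_shift step_shift.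
move=> a; exists (fun x => phi a (cshift x)); last first.
  exact: aeW.
have mphi : measurable_fun setT (phi a : borel_config -> R).
  exact: uniformly_local_measurable.
have bphis : bounded_obs (phi a \o cshift).
  by have [M hM] := phi_bounded a; exists M => x; exact: hM.
have uphis : uniformly_local (phi a \o cshift) by exact: uniformly_local_shift.
have mphis : measurable_fun setT (phi a \o cshift : borel_config -> R).
  exact: uniformly_local_measurable.
have intphis D : measurable D -> mu.-integrable D (EFin \o (phi a \o cshift)).
  by move=> mD; exact: bounded_obs_integrable.
split.
- move=> Y mY; exists (phi a @^-1` Y); last by rewrite setTI.
  by rewrite -[X in measurable X]setTI; exact: mphi.
- exact: intphis.
pose m1 (B : set borel_config) := (\int[mu]_(x in B) (phi a (cshift x))%:E)%E.
have fm1 : finite_measure m1.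
  split.
  + by rewrite /m1 integral_set0.
  + by move=> A; apply: integral_ge0 => x _; rewrite lee_fin;
    have /andP[] := phi01 a (cshift x).
  + apply: semi_sigma_additive_nng_induced; first exact/measurable_EFinP.
    by move=> x; rewrite lee_fin; have /andP[] := phi01 a (cshift x).
  + have := integrable_fin_num measurableT (intphis _ measurableT).
    by rewrite fin_numElt => /andP[].
pose Ea : set borel_config := [set x | x 0%N = a].
have Eal : is_local (Ea : set config).
  by exists 1%N => x y xy; rewrite /Ea /mkset xy.
have fm2 := finite_measure_probability mu (local_measurable Eal).
move=> _ [B mB <-]; rewrite setTI.
apply: (measure_eq_of_local (finite_measure_cshift fm1) (finite_measure_cshift fm2)) mB.
move=> A Al.
have lA := local_cshift _ Al.
transitivity (L (fun x => (phi a \o cshift) x * \1_(cshift @^-1` A) x))%:E.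
  rewrite -(integral_uniformly_local HL muL uphis bphis lA) /Rintegral fineK//.
  by apply: integrable_fin_num; [exact: local_measurable | apply: intphis;
    exact: local_measurable].
rewrite muL; last exact: local_setsI.
congr (_%:E).
rewrite -(Linv \1_(Ea `&` cshift @^-1` A)); last exact: bounded_obs_indic.
rewrite -(Linv (fun x => _ * _)); last by apply: bounded_obsM => //;
  exact: bounded_obs_indic.
congr L.
have -> : (fun x => (phi a \o cshift) x * \1_(cshift @^-1` A) x) =
  (phi a \* \1_A) \o cshift.
  by apply/funext => x; rewrite /= indic_shift.
rewrite step_shift; apply/funext => x.
rewrite /step !indicE !in_setI.
have Eb b : (concat b x \in Ea) = (b == a).
  by apply/idP/eqP => [/set_mem//|->]; exact/mem_set.
have Ab b : (concat b x \in cshift @^-1` A) = (x \in (A : set config)).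
  by apply/idP/idP => /set_mem h; exact/mem_set.
rewrite !Eb !Ab -g_false /= indicE /phi.
by case: a {mphi bphis uphis mphis intphis m1 fm1 Ea Eal fm2 Eb} => /=;
  rewrite ?mulr0 ?addr0 ?add0r.
Qed.

End GMeasureExistence.

(** * The Bramson-Kalikow model *)

Section BramsonKalikow.
Context {R : realType} (eps alpha : R) (lambda : nat -> R) (m r : nat -> nat).
Hypothesis heps : 0 < eps < 1 / 2.
Hypothesis hlambda : forall j : nat, (1 <= j)%N -> 0 < lambda j.
Hypothesis hsum : (fun n : nat => \sum_(1 <= j < n) lambda j) @ \oo --> (1 : R).
Hypothesis hm0 : m 0%N = 0%N.
Hypothesis hmodd : forall j : nat, (1 <= j)%N -> odd (m j).
Hypothesis hmincr : forall i j : nat, (1 <= i)%N -> (i < j)%N -> (m i < m j)%N.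
Implicit Types (x y : config).

(** The rules are numbered from 1, so the bound k.+1 keeps the first k of them. *)
Definition weight k : R := \sum_(1 <= j < k.+1) lambda j.

Lemma weightS k : weight k.+1 = weight k + lambda k.+1.
Proof. by rewrite /weight big_nat_recr. Qed.

Lemma weight0 : weight 0 = 0.
Proof. by rewrite /weight big_geq. Qed.

Lemma weight_cvg : weight @ \oo --> (1 : R).
Proof. by have := hsum; rewrite -cvg_shiftS. Qed.

Lemma weight_nondecreasing : {homo weight : i j / (i <= j)%N >-> i <= j}.
Proof. by apply: homo_leq => // [|k]; [exact: le_trans |
  rewrite weightS lerDl ltW// hlambda]. Qed.

Lemma weight_le1 k : weight k <= 1.
Proof.
rewrite -(cvg_lim _ weight_cvg)//; apply: nondecreasing_cvgn_le.
  by move=> i j; exact: weight_nondecreasing.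
by apply/cvg_ex; exists 1; exact: weight_cvg.
Qed.

Lemma sub_weight k l : (k <= l)%N -> \sum_(k.+1 <= j < l.+1) lambda j =
  weight l - weight k.
Proof.
by move=> kl; rewrite /weight (@big_cat_nat _ _ _ k.+1 1 l.+1)//= addrAC subrr add0r.
Qed.

Lemma tail_weight k : \big[+%R/0]_(k.+1 <= j <oo) lambda j = 1 - weight k.
Proof.
apply: cvg_lim => //.
have h : (fun n => weight n.-1 - weight k) @ \oo --> 1 - weight k.
  apply: cvgB; last exact: cvg_cst.
  by rewrite -cvg_shiftS; exact: weight_cvg.
have E l : (k < l)%N -> weight l.-1 - weight k = \sum_(k.+1 <= j < l) lambda j.
  by case: l => // l kl; rewrite sub_weight.
apply: cvg_trans h; apply: near_eq_cvg; near=> n; apply/E.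
by near: n; exact: nbhs_infty_gt.
Unshelve. all: by end_near. Qed.

Definition signed_sum k x : R :=
  \sum_(1 <= j < k.+1) lambda j * majority_sign (m j) x.

Lemma signed_sumS k x :
  signed_sum k.+1 x = signed_sum k x + lambda k.+1 * majority_sign (m k.+1) x.
Proof. by rewrite /signed_sum big_nat_recr. Qed.

Lemma signed_sum_diff k l x : (k <= l)%N ->
  `|signed_sum l x - signed_sum k x| <= weight l - weight k.
Proof.
elim: l => [|l IH]; first by rewrite leqn0 => /eqP->; rewrite !subrr normr0.
rewrite leq_eqVlt => /orP[/eqP->|]; first by rewrite !subrr normr0.
rewrite ltnS => /IH; rewrite signed_sumS weightS !ler_norml => h.
have /andP[h1 h2] := @majority_sign_bound R (m l.+1) x; have := @hlambda l.+1 isT.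
nra.
Qed.

Lemma signed_sum0 x : signed_sum 0 x = 0.
Proof. by rewrite /signed_sum big_geq. Qed.

Lemma signed_sum_bound k x : `|signed_sum k x| <= weight k.
Proof. by have := @signed_sum_diff 0 k x isT; rewrite signed_sum0 weight0 !subr0. Qed.

Lemma signed_sum_increasing k : increasing (signed_sum k).
Proof.
move=> x y xy; rewrite /signed_sum !big_nat; apply: ler_sum => j /andP[j1 _].
by rewrite ler_wpM2l ?majority_sign_increasing// ltW// hlambda.
Qed.

Lemma m_mono i j : (i <= j)%N -> (m i <= m j)%N.
Proof.
case: i => [|i]; first by rewrite hm0.
by rewrite leq_eqVlt => /orP[/eqP->//|ij]; exact/ltnW/hmincr.
Qed.

Lemma signed_sum_local k : local (m k) (signed_sum k).
Proof.
move=> x y xy; apply: eq_big_nat => j /andP[_ jk]; congr (_ * _).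
by apply: (localW (m_mono _) (@majority_sign_local R (m j))) xy.
Qed.

Lemma signed_sum_flip k x : signed_sum k (flip x) = - signed_sum k x.
Proof.
rewrite /signed_sum -sumrN; apply: eq_big_nat => j /andP[j1 _].
by rewrite majority_sign_flip ?mulrN// hmodd.
Qed.

Definition signed_limit x : R := limn (signed_sum ^~ x).

Lemma signed_sum_cvg x : signed_sum ^~ x @ \oo --> signed_limit x.
Proof.
have vc : cvgn (fun k => weight k + signed_sum k x).
  apply: nondecreasing_is_cvgn.
    apply/nondecreasing_seqP => k; rewrite weightS signed_sumS.
    have := @majority_sign_bound R (m k.+1) x; have := @hlambda k.+1 isT; nra.
  exists 2 => _ [k _ <-]; have := weight_le1 k; have := signed_sum_bound k x.
  rewrite ler_norml; lra.
suff : cvgn (signed_sum ^~ x) by [].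
have -> : signed_sum ^~ x = (fun k => (weight k + signed_sum k x) - weight k).
  by apply/funext => k; rewrite addrAC subrr add0r.
apply: is_cvgB; first exact: vc.
by apply/cvg_ex; exists 1; exact: weight_cvg.
Qed.

Lemma signed_limit_approx k x : `|signed_limit x - signed_sum k x| <= 1 - weight k.
Proof.
have h : (fun l => `|signed_sum l x - signed_sum k x|) @ \oo -->
    `|signed_limit x - signed_sum k x|.
  by apply: cvg_norm; apply: cvgB; [exact: signed_sum_cvg | exact: cvg_cst].
rewrite -(cvg_lim _ h)//; apply: limr_le; first by apply/cvg_ex; eexists; exact: h.
near=> l; have kl : (k <= l)%N by near: l; exact: nbhs_infty_ge.
by apply: (le_trans (signed_sum_diff x kl)); rewrite lerB// weight_le1.
Unshelve. all: by end_near. Qed.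

Lemma signed_limit_bound x : -1 <= signed_limit x <= 1.
Proof.
by have := signed_limit_approx 0 x; rewrite signed_sum0 weight0 !subr0 ler_norml.
Qed.

Lemma signed_limit_flip x : signed_limit (flip x) = - signed_limit x.
Proof.
apply: cvg_lim => //; under eq_fun do rewrite signed_sum_flip.
by apply: cvgN; exact: signed_sum_cvg.
Qed.

Lemma spin_sum_cshift n x :
  spin_sum n (cshift x) = \sum_(1 <= l < n.+1) spin (x l) :> R.
Proof. by rewrite big_add1. Qed.

Lemma majorityE n x : odd n ->
  majority eps n x = 1 / 2 + (1 / 2 - eps) * (spin0 x * majority_sign n (cshift x)) :> R.
Proof.
move=> on; rewrite /majority -spin_sum_cshift /majority_sign /spin0.
have := @spin_sum_neq0 R n (cshift x) on; set s := spin_sum n (cshift x).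
rewrite /spin; case: (x 0%N); rewrite ?mul1r ?mulN1r ?oppr_gt0 ?oppr_lt0;
 case: (ltgtP 0 s) => //= _ _; rewrite ?mulr1n ?mulr0n; lra.
Qed.

Lemma bramson_kalikowE x :
  bramson_kalikow eps lambda m x =
  1 / 2 + (1 / 2 - eps) * (spin0 x * signed_limit (cshift x)).
Proof.
apply: cvg_lim => //.
have E : (fun n => \sum_(1 <= j < n.+1) lambda j * majority eps (m j) x) =
  (fun n => 1 / 2 * weight n + (1 / 2 - eps) * (spin0 x * signed_sum n (cshift x))).
  apply/funext => n; rewrite /weight /signed_sum !mulr_sumr -big_split/=.
  apply: eq_big_nat => j /andP[j1 _]; rewrite majorityE ?hmodd//.
  ring.
rewrite -cvg_shiftS [X in X @ _ --> _]E.
apply: cvgD.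
  by rewrite -[in X in _ --> X](mulr1 (1 / 2)); apply: cvgMl_tmp; exact: weight_cvg.
by do 2 apply: cvgMl_tmp; exact: signed_sum_cvg.
Qed.

(** The chain that uses the first k majority rules and lets all the others vote
    plus. *)
Definition truncated k : config -> R :=
  heat eps (fun x => signed_sum k x + (1 - weight k)).

Lemma truncated_field_bound k x : -1 <= signed_sum k x + (1 - weight k) <= 1.
Proof.
have := signed_sum_bound k x; have := weight_le1 k; rewrite ler_norml; lra.
Qed.

Lemma truncated_prob_valued k : prob_valued (truncated k).
Proof. by apply: heat_prob_valued => // x; exact: truncated_field_bound. Qed.

Lemma truncated_increasing k : increasing (truncated k).
Proof.
by apply: heat_increasing => // x y xy; rewrite lerD2r signed_sum_increasing.
Qed.

Hypothesis hr : forall k : nat, (1 <= k)%N -> (r k < k)%N.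
Hypothesis halpha : 0 < alpha < 1 / 2 - eps.
Hypothesis hgap : forall k : nat,
       \sum_((r k.+1).+1 <= j < k.+2) lambda j
         < \big[+%R/0]_(k.+2 <= j <oo) lambda j.
Hypothesis hgrowth : forall k : nat,
       A_bound eps alpha m r k / gap lambda r k ^+ 2 <= (m k.+1)%:R.

Let rle k : (r k.+1 <= k)%N.
Proof. by rewrite -ltnS hr. Qed.

Lemma gapE k :
  gap lambda r k = 1 - weight k.+1 - (weight k.+1 - weight (r k.+1)).
Proof. by rewrite /gap tail_weight sub_weight// leqW. Qed.

Lemma gap_gt0 k : 0 < gap lambda r k.
Proof. by rewrite /gap subr_gt0. Qed.

Lemma gap_field_bound k x :
  -1 <= signed_sum (r k.+1) x + gap lambda r k <= 1.
Proof.
have := signed_sum_bound (r k.+1) x; have := gap_gt0 k; rewrite gapE ler_norml.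
have := weight_le1 k.+1; have := weight_nondecreasing (leqW (rle k)); lra.
Qed.

Lemma signed_sum_field_bound k x : -1 <= signed_sum k x <= 1.
Proof. have := signed_sum_bound k x; have := weight_le1 k; rewrite ler_norml; lra. Qed.

(** The inverse of the argument of the logarithm in A_bound. *)
Definition minority_bound k : R := alpha / (2 ^+ k.+2 * memory_cost eps (m k)).

Lemma ln8_ge : 3 / 2 <= ln 8 :> R.
Proof.
rewrite -ler_expR lnK ?posrE; last lra.
have h := @expR_le_quad R (1 / 2) ltac:(lra).
have h2 := expR_gt0 (1 / 2 : R).
have -> : 3 / 2 = 1 / 2 + 1 / 2 + 1 / 2 :> R by field.
rewrite !expRD; set e := expR _ in h h2 *; nra.
Qed.

Lemma minority_bound_gt0 k : 0 < minority_bound k.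
Proof.
have a0 : 0 < alpha by case/andP: halpha.
have c0 : 0 < memory_cost eps (m k) by have := memory_cost_ge1 heps (m k); lra.
by rewrite /minority_bound divr_gt0// mulr_gt0// exprn_gt0.
Qed.

Lemma growth_exponent k :
  let X := (m k.+1)%:R * ((1 - 2 * eps) * gap lambda r k) ^+ 2 /
    (8 * memory_cost eps (m (r k.+1)) ^+ 2) in
  3 / 2 <= X /\ expR (- X) <= minority_bound k.
Proof.
move=> X; have /andP[e0 e1] := heps; have /andP[a0 a1] := halpha.
have g0 := gap_gt0 k.
set C := memory_cost eps (m (r k.+1)) in X *.
have C1 : 1 <= C by exact: memory_cost_ge1.
set Z := 2 ^+ k.+2 * memory_cost eps (m k) * alpha^-1.
have ZE : minority_bound k = Z^-1 by rewrite /minority_bound /Z invf_div.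
have Z8 : 8 <= Z.
  have h1 : 4 <= 2 ^+ k.+2 :> R.
    have : 1 <= 2 ^+ k :> R by rewrite exprn_ege1// ler1n.
    by rewrite !exprS; lra.
  have h2 := memory_cost_ge1 heps (m k).
  have h3 : 2 <= alpha^-1 by rewrite -[2]invrK lef_pV2 ?posrE//; lra.
  have h4 : 4 <= 2 ^+ k.+2 * memory_cost eps (m k) by nra.
  by rewrite /Z; nra.
have XZ : ln Z <= X.
  have : A_bound eps alpha m r k <= (m k.+1)%:R * gap lambda r k ^+ 2.
    by rewrite -ler_pdivrMr ?exprn_gt0// hgrowth.
  rewrite /A_bound -!/(memory_cost eps _) -/C -/Z => h.
  rewrite /X ler_pdivlMr; last by rewrite mulr_gt0// exprn_gt0//; lra.
  have E1 : ln Z * (8 * C ^+ 2) =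
      (1 - 2 * eps) ^+ 2 * (8 * (1 - 2 * eps) ^- 2 * C ^+ 2 * ln Z).
    by field; rewrite gt_eqF//; lra.
  rewrite E1 exprMn [leRHS]mulrCA.
  exact: (ler_wpM2l (sqr_ge0 (1 - 2 * eps)) h).
have h : 3 / 2 <= X.
  apply: le_trans XZ; apply: (le_trans ln8_ge); rewrite ler_ln ?posrE//; lra.
split => //.
have Z0 : 0 < Z by lra.
by rewrite ZE -[Z^-1]lnK ?posrE ?invr_gt0// ler_expR lnV ?posrE// lerN2.
Qed.

(** Replacing the rules after r k.+1 and up to k.+1 by constant minus votes can
    only lower the spins, and leaves a chain of memory m (r k.+1) with field gap;
    the law of large numbers of that chain makes a majority of minus spins in a
    block of length m k.+1 unlikely. *)
Lemma truncated_minority k i :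
  iter i (step (truncated k.+1)) (fun y =>
    (spin_sum (m k.+1) y <= 0 :> R)%R%:R) all_plus
  <= minority_bound k.
Proof.
pose q := heat eps (fun x => signed_sum (r k.+1) x + gap lambda r k).
have /andP[e0 e1] := heps.
have qel : elliptic eps q by apply: heat_elliptic => // x; exact: gap_field_bound.
have hq := elliptic_prob_valued heps qel.
have qi : increasing q.
  by apply: heat_increasing => // x y xy; rewrite lerD2r signed_sum_increasing.
have ql : local (m (r k.+1)) q.
  by move=> x y xy; rewrite /q /heat (signed_sum_local xy).
have q_le x : q x <= truncated k.+1 x.
  have : signed_sum (r k.+1) x + gap lambda r k <= signed_sum k.+1 x + (1 - weight k.+1).
    rewrite gapE; have := signed_sum_diff x (leqW (rle k)); rewrite ler_norml; lra.
  rewrite /q /truncated /heat; nra.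
have g0 := gap_gt0 k.
have g1 : gap lambda r k <= 1.
  rewrite gapE; have := weight_nondecreasing (leqW (rle k)).
  have := weight_nondecreasing (leq0n k.+1); rewrite weight0; lra.
have hmag u : (1 - 2 * eps) * gap lambda r k <= iter u.+1 (step q) spin0 all_plus.
  apply: magnetization_ge_field => //.
  - exact: ltW.
  - exact: signed_sum_field_bound.
  - exact: gap_field_bound.
  - exact: signed_sum_increasing.
  - exact: signed_sum_flip.
have [hX1 hX2] := growth_exponent k.
pose g y : R := (0 < spin_sum (m k.+1) y :> R)%R%:R.
have gi : increasing g.
  move=> x y /(@spin_sum_increasing R (m k.+1)); rewrite /g.
  by case: (ltP 0 (spin_sum _ x)); case: (ltP 0 (spin_sum _ y)); rewrite ?ler01//; lra.
have gE : (fun y => (spin_sum (m k.+1) y <= 0 :> R)%R%:R) = (fun y => -1 * g y + 1).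
  apply/funext => y; rewrite /g; case: (ltP 0 (spin_sum _ y)) => _ /=;
   rewrite ?mulr1n ?mulr0n; ring.
rewrite gE iter_step_affine.
suff : 1 - minority_bound k <= iter i (step (truncated k.+1)) g all_plus by lra.
apply: (le_trans _ (iter_step_le_drift i hq (truncated_prob_valued k.+1) qi q_le gi _)).
apply: (le_trans _ (@iter_step_all_plus_nonincr R q g i (m k.+1) hq qi gi)).
rewrite addnC iterD; apply: iter_step_ge_cst => // y.
have hb : 0 <= (1 - 2 * eps) * gap lambda r k <= 1 by nra.
have := block_sum_concentration heps qel ql hb hmag hX1 y.
rewrite gE iter_step_affine; lra.
Qed.

(** The two fields differ by lambda k.+1 * (1 - majority_sign), which vanishes
    unless the block of length m k.+1 has a minus majority. *)
Lemma truncated_step_loss k n :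
  iter n (step (truncated k)) plus_spin all_plus -
  iter n (step (truncated k.+1)) plus_spin all_plus <= alpha / 2 ^+ k.+2.
Proof.
have /andP[e0 e1] := heps.
have tel : elliptic eps (truncated k).
  by apply: heat_elliptic => // x; exact: truncated_field_bound.
have tl : local (m k) (truncated k).
  by move=> x y xy; rewrite /truncated /heat (signed_sum_local xy).
have [d [d0 hd dC]] := memory_decay heps tel tl.
pose e y : R := (spin_sum (m k.+1) y <= 0 :> R)%R%:R.
have lam1 : lambda k.+1 <= 1.
  have := weight_le1 k.+1; rewrite weightS.
  by have := weight_nondecreasing (leq0n k); rewrite weight0; lra.
have lam0 := @hlambda k.+1 isT.
have h := @iter_step_compare R (truncated k.+1) (truncated k) plus_spin e d
  (minority_bound k) n all_plus (truncated_prob_valued _) (truncated_prob_valued _)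
  (@truncated_increasing _) plus_spin_increasing.
apply: (le_trans (h _ _ _ hd)).
- by move=> y; rewrite /e ler0n.
- move=> y; rewrite /truncated /heat signed_sumS weightS /e /majority_sign.
  case: (ltP 0 (spin_sum _ y)) => _ /=; rewrite ?mulr1n ?mulr0n; nra.
- by move=> i; exact: truncated_minority.
- have c1 := memory_cost_ge1 heps (m k).
  apply: (le_trans (ler_wpM2l (ltW (minority_bound_gt0 k)) (dC n))).
  rewrite le_eqVlt; apply/orP; left; apply/eqP; rewrite /minority_bound; field.
  by rewrite expf_neq0// gt_eqF//; lra.
Qed.

(** The losses alpha / 2^(k+2) add up to alpha / 2 - alpha / 2^(k+1) before stage
    k, starting from 1 - eps at k = 0. *)
Lemma truncated_plus k n :
  1 - eps - alpha / 2 <= iter n (step (truncated k)) plus_spin all_plus.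
Proof.
have /andP[a0 a1] := halpha; have /andP[e0 e1] := heps.
suff : 1 - eps - alpha / 2 + alpha / 2 ^+ k.+1 <=
    iter n (step (truncated k)) plus_spin all_plus.
  apply: le_trans; rewrite lerDl divr_ge0 ?exprn_ge0//; lra.
elim: k => [|k IH]; last first.
  have := truncated_step_loss k n.
  have E : alpha / 2 ^+ k.+1 = alpha / 2 ^+ k.+2 + alpha / 2 ^+ k.+2.
    by rewrite [2 ^+ k.+2]exprS; field; rewrite expf_neq0.
  by move: IH; rewrite E; lra.
rewrite expr1 subrK; case: n => [|n].
  by rewrite /= /plus_spin /all_plus /= mulr1n; lra.
rewrite iterSr; apply: iter_step_ge_cst; first exact: truncated_prob_valued.
move=> y; rewrite step_plus_spin /truncated /heat signed_sum0 weight0; lra.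
Qed.

Definition bk_plus : config -> R := heat eps signed_limit.

Lemma bk_plus_prob_valued : prob_valued bk_plus.
Proof. exact: heat_prob_valued signed_limit_bound. Qed.

(** For fixed n the truncated chain and the full one differ by at most
    (1 - weight k) n, so the bound for the truncated chains passes to the limit. *)
Lemma bk_plus_magnetized n :
  1 - eps - alpha / 2 <= iter n (step bk_plus) plus_spin all_plus.
Proof.
have /andP[e0 e1] := heps.
have h k : 1 - eps - alpha / 2 - (1 - weight k) * n%:R <=
    iter n (step bk_plus) plus_spin all_plus.
  suff : iter n (step (truncated k)) plus_spin all_plus -
         iter n (step bk_plus) plus_spin all_plus <= (1 - weight k) * \sum_(0 <= u < n) 1.
    by rewrite sumr_const_nat subn0; have := truncated_plus k n; lra.
  apply: (@iter_step_compare _ _ _ _ (fun=> 1 - weight k) (fun=> 1)).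
  - exact: bk_plus_prob_valued.
  - exact: truncated_prob_valued.
  - exact: truncated_increasing.
  - exact: plus_spin_increasing.
  - by move=> y; rewrite subr_ge0 weight_le1.
  - move=> y; have := signed_limit_approx k y; have := weight_le1 k.
    rewrite /truncated /bk_plus /heat ler_norml; nra.
  - by move=> i; rewrite iter_step_cst.
  - by move=> u; apply: osc_step; [exact: truncated_prob_valued | exact: osc_plus_spin].
have hc : (fun k => 1 - eps - alpha / 2 - (1 - weight k) * n%:R) @ \oo -->
   1 - eps - alpha / 2 - (1 - 1) * n%:R.
  apply: cvgB; first exact: cvg_cst.
  apply: cvgMr_tmp; apply: cvgB; [exact: cvg_cst|exact: weight_cvg].
rewrite [leLHS](_ : _ = 1 - eps - alpha / 2 - (1 - 1) * n%:R); last by ring.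
by apply: (cvgr_to_le hc); exact: nearW.
Qed.

Lemma weight_near1 (e : R) : 0 < e -> exists k, 1 - weight k <= e.
Proof.
move=> e0; have /cvgrPdist_le /(_ e e0) [k _ /(_ k (leqnn k)) /=] := weight_cvg.
by rewrite ler_norml => /andP[_ h]; exists k.
Qed.

Lemma bramson_kalikow_uniformly_local :
  uniformly_local (bramson_kalikow eps lambda m : config -> R).
Proof.
move=> e /weight_near1[k hk]; have /andP[e0 e1] := heps.
exists (fun x => 1 / 2 + (1 / 2 - eps) * (spin0 x * signed_sum k (cshift x))).
  exists (m k).+1 => x y xy.
  have E : signed_sum k (cshift x) = signed_sum k (cshift y).
    exact: (local_shift (@signed_sum_local k) xy).
  by rewrite E /spin0 xy.
move=> x; rewrite bramson_kalikowE.
have h := signed_limit_approx k (cshift x).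
set a := signed_limit _ in h *; set b := signed_sum _ _ in h *.
have -> : 1 / 2 + (1 / 2 - eps) * (spin0 x * a) - (1 / 2 + (1 / 2 - eps) * (spin0 x * b))
  = (1 / 2 - eps) * (spin0 x * (a - b)) by ring.
have -> : `|(1 / 2 - eps) * (spin0 x * (a - b))| = (1 / 2 - eps) * `|a - b|.
  rewrite !normrM ger0_norm; last by lra.
  congr (_ * _); rewrite /spin0 /spin; case: (x 0%N); first by rewrite normr1 mul1r.
  by rewrite normrN1 mul1r.
have := normr_ge0 (a - b); nra.
Qed.

Lemma bramson_kalikow_concat a x :
  bramson_kalikow eps lambda m (concat a x) =
    1 / 2 + (1 / 2 - eps) * (spin a * signed_limit x).
Proof.
rewrite bramson_kalikowE /spin0 /=.
by have -> : cshift (concat a x) = x by apply/funext.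
Qed.

Lemma bramson_kalikow_g_function :
  g_function (bramson_kalikow eps lambda m : config -> R).
Proof.
have /andP[e0 e1] := heps.
split.
- exact: uniformly_local_continuous bramson_kalikow_uniformly_local.
- move=> x; rewrite bramson_kalikowE.
  have := signed_limit_bound (cshift x).
  by rewrite /spin0 /spin; case: (x 0%N); nra.
- by move=> x; rewrite big_bool /= !bramson_kalikow_concat /spin; field.
Qed.

Lemma bramson_kalikow_plus :
  (fun x => bramson_kalikow eps lambda m (concat true x)) = bk_plus.
Proof. by apply/funext => x;
  rewrite bramson_kalikow_concat /spin (mul1r (signed_limit x)). Qed.

(** The all-minus start is the mirror image of the all-plus start. *)
Lemma bk_minus_magnetized n :
  1 - eps - alpha / 2 <=
  iter n (step bk_plus) \1_[set x : config | x 0%N = false] (flip all_plus).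
Proof.
rewrite iter_step_flip; last by move=> y; rewrite /bk_plus /heat signed_limit_flip;
  field.
have -> : \1_[set x : config | x 0%N = false] \o flip = plus_spin :> (config -> R).
  apply/funext => x; rewrite /= indicE /plus_spin /flip; congr (nat_of_bool _)%:R.
  apply/idP/idP => [/set_mem h|h]; first exact: negbFE.
  by apply/mem_set; rewrite /mkset h.
exact: bk_plus_magnetized.
Qed.

Lemma bramson_kalikow_nonunique : exists mu nu : probability borel_config R,
  [/\ g_measure (bramson_kalikow eps lambda m) mu,
      g_measure (bramson_kalikow eps lambda m) nu &
      exists B : set borel_config, measurable B /\ mu B <> nu B].
Proof.
have gg := bramson_kalikow_g_function.
have qu : uniformly_local (fun x => bramson_kalikow eps lambda m (concat true x) : R).
  move=> e /bramson_kalikow_uniformly_local [h [n hl] bh].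
  exists (fun x => h (concat true x)); last by move=> x; exact: bh.
  by exists n => x y xy; apply: hl => -[|i] //= /ltnW /xy.
have [mu [gmu hmu]] := @g_measure_exists R _ all_plus gg qu.
have [nu [gnu hnu]] := @g_measure_exists R _ (flip all_plus) gg qu.
exists mu, nu; split => //.
pose B b : set borel_config := [set x : config | x 0%N = b].
have Bl b : is_local (B b : set config).
  by exists 1%N => x y xy; rewrite /B /mkset xy.
exists (B true); split; first exact: local_measurable.
(* Both measures would give mass more than 1/2 to disjoint events. *)
have hp : ((1 - eps - alpha / 2)%:E <= mu (B true))%E.
  apply: hmu => // n; rewrite bramson_kalikow_plus.
  have -> : \1_(B true) = plus_spin :> (config -> R).
    apply/funext => x; rewrite indicE /plus_spin; congr (nat_of_bool _)%:R.
    by apply/idP/idP => [/set_mem h|h]; [exact: h|exact/mem_set].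
  exact: bk_plus_magnetized.
have hm : ((1 - eps - alpha / 2)%:E <= nu (B false))%E.
  apply: hnu => // n; rewrite bramson_kalikow_plus.
  exact: bk_minus_magnetized.
move=> E.
have : (nu (B true) + nu (B false) = 1)%E.
  have -> : B false = ~` B true.
    apply/seteqP; split => x; rewrite /B /=; first by move=> ->.
    by case: (x 0%N) => // /(_ erefl).
  have mB := local_measurable (Bl true).
  rewrite -measureU ?setUCr ?setICr//; first exact: probability_setT.
  exact: measurableC.
rewrite -E => h.
have : ((1 - eps - alpha / 2)%:E + (1 - eps - alpha / 2)%:E <= 1 :> \bar R)%E.
  by rewrite -h leeD.
rewrite -EFinD lee_fin; have := heps; have := halpha; lra.
Qed.

End BramsonKalikow.

Theorem theorem1 (R : realType) (eps alpha : R) (lambda : nat -> R)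
    (m r : nat -> nat)
    (heps : 0 < eps < 1 / 2)
    (hlambda : forall j : nat, (1 <= j)%N -> 0 < lambda j)
    (hsum : (fun n : nat => \sum_(1 <= j < n) lambda j) @ \oo --> (1 : R))
    (hm0 : m 0%N = 0%N)
    (hmodd : forall j : nat, (1 <= j)%N -> odd (m j))
    (hmincr : forall i j : nat, (1 <= i)%N -> (i < j)%N -> (m i < m j)%N)
    (hr : forall k : nat, (1 <= k)%N -> (r k < k)%N)
    (halpha : 0 < alpha < 1 / 2 - eps)
    (hgap : forall k : nat,
       \sum_((r k.+1).+1 <= j < k.+2) lambda j
         < \big[+%R/0]_(k.+2 <= j <oo) lambda j)
    (hgrowth : forall k : nat,
       A_bound eps alpha m r k / gap lambda r k ^+ 2 <= (m k.+1)%:R) :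
  exists mu nu : probability borel_config R,
    [/\ g_measure (bramson_kalikow eps lambda m) mu,
        g_measure (bramson_kalikow eps lambda m) nu &
        exists B : set borel_config, measurable B /\ mu B <> nu B].
Proof. exact: bramson_kalikow_nonunique hr halpha hgap hgrowth. Qed.
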